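(* Let $b,N\in\mathbb{Z}$ with $b\ge 1$, $N\ge 6$ and $N\equiv 2\pmod 4$. Define $f_{N,b}(x):=x^N-N(N-1)^bx-(N-1)$ and $\delta:=(N-1)^{bN}+1$. Suppose that $f_{N,b}(x)$ is irreducible over $\mathbb{Q}$. Then $f_{N,b}(x)$ is monogenic if and only if $N(N-1)$ and $\delta$ are both squarefree. Furthermore, no two distinct such monogenic trinomials $f_{N,b}(x)$ (for the same $N$) generate the same degree-$N$ extension of $\mathbb{Q}$, and $bN/2$ divides the class number of the real quadratic field $\mathbb{Q}(\sqrt{\delta})$.
   Context: A monic polynomial $f(x)\in\mathbb{Z}[x]$ of degree $N\ge 2$ is called monogenic if $f(x)$ is irreducible over $\mathbb{Q}$ and $\{1,\theta,\ldots,\theta^{N-1}\}$ is a basis for the ring of integers of $\mathbb{Q}(\theta)$, where $f(\theta)=0$. ''Generate the same extension'' means that $\mathbb{Q}(\theta_1)=\mathbb{Q}(\theta_2)$ for roots $\theta_1,\theta_2$ of the two polynomials. *)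

(* Defs.v *)
From HB Require Import structures.
From mathcomp Require Import all_boot all_order all_algebra all_field.
From mathcomp Require Import all_classical.

Set Implicit Arguments.
Unset Strict Implicit.
Unset Printing Implicit Defensive.

Import Order.TTheory GRing.Theory Num.Theory.
Local Open Scope classical_set_scope.
Local Open Scope card_scope.
Local Open Scope ring_scope.

Definition squarefree (n : nat) : Prop :=
  forall d : nat, (d ^ 2 %| n)%N -> d = 1%N.

(* Number fields are subfields of algC, given as sets. *)

(* Q(z), the field of values at z of rational fractions over Q. *)
Definition adjoinQ (z : algC) : set algC :=
  [set x | exists p q : {poly rat},
     (map_poly ratr q).[z] != 0 /\
     x = (map_poly ratr p).[z] / (map_poly ratr q).[z]].

Definition ring_of_integers (K : set algC) : set algC :=
  [set x | K x /\ x \in Aint].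

Definition is_Zbasis (n : nat) (e : 'I_n -> algC) (M : set algC) : Prop :=
  (forall i, M (e i)) /\
  (forall x, M x -> exists! c : {ffun 'I_n -> int},
     x = \sum_(i < n) (c i)%:~R * e i).

Definition irreducibleQ (f : {poly int}) : Prop :=
  irreducible_poly (map_poly intr f : {poly rat}).

Definition croot (f : {poly int}) (z : algC) : bool :=
  root (map_poly intr f) z.

(* The degree is (size f).-1, so degree >= 2 reads 2 < size f. *)
Definition monogenic (f : {poly int}) : Prop :=
  [/\ f \is monic, (2 < size f)%N, irreducibleQ f &
      forall theta : algC, croot f theta ->
        is_Zbasis (fun i : 'I_(size f).-1 => theta ^+ i)
                  (ring_of_integers (adjoinQ theta))].

Definition same_extension (f g : {poly int}) : Prop :=
  exists theta1 theta2 : algC,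
    [/\ croot f theta1, croot g theta2 & adjoinQ theta1 = adjoinQ theta2].

Definition nonzero_ideal (A I : set algC) : Prop :=
  [/\ I `<=` A, I 0,
      forall x y, I x -> I y -> I (x + y),
      forall a x, A a -> I x -> I (a * x) &
      exists2 x, I x & x != 0].

Definition ideal_equiv (A I J : set algC) : Prop :=
  exists a b : algC,
    [/\ A a /\ a != 0, A b /\ b != 0 & ( *%R a) @` I = ( *%R b) @` J].

Definition ideal_class (A I : set algC) : set (set algC) :=
  [set J | nonzero_ideal A J /\ ideal_equiv A I J].

(* Every class of nonzero fractional ideals modulo principal ones contains an
   integral ideal, so these classes are the elements of the class group. *)
Definition ideal_classes (A : set algC) : set (set (set algC)) :=
  ideal_class A @` nonzero_ideal A.

(* A relation, so that asserting that h is the class number of K includes the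
   finiteness of the set of ideal classes. *)
Definition is_class_number (K : set algC) (h : nat) : Prop :=
  ideal_classes (ring_of_integers K) #= `I_h.

Definition trinomial (N b : nat) : {poly int} :=
  'X^N - (N%:Z * (N%:Z - 1) ^+ b)%:P * 'X - (N%:Z - 1)%:P.

Definition delta (N b : nat) : nat := ((N - 1) ^ (b * N) + 1)%N.

(* Main.v *)
(* Dedekind's criterion, in Uchida's form: Z[x]/(f) is p-maximal iff f lies in
   no m^2, where m = (p, Phi) is a maximal ideal of Z[x] containing f.  Write
   M = N - 1, L = M^b x + 1.  The identities
     x f' - N f = N M L,   M^(bN) f = delta (1 - N L) mod L^2
   show that f in m^2 forces p^2 | N M or p^2 | delta; conversely, each of these
   gives an explicit Phi with f in (p, Phi)^2.
   If b < b', a prime p dividing delta_b' but not delta_b makes f_b separable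
   and f_b' non-separable mod p, so Z[theta] and Z[theta'] differ.
   For the class number, delta = t^2 + 1 with t = M^n, n = bN/2, and the ideal
   P = (M, 1 + sqrt delta) satisfies P^(2n) = (1 + sqrt delta).  If P^k were
   principal with 0 < k <= n, a generator would be primitive of norm at most t
   in absolute value, which forces norm 1 or -1.  So multiplication by P acts
   freely on the classes as a cyclic group of order 2n. *)
Require Import Defs.
From HB Require Import structures.
From mathcomp Require Import all_boot all_order all_algebra all_field.
From mathcomp Require Import all_classical.
From mathcomp Require Import zify ring.
Import Order.TTheory GRing.Theory Num.Theory.
Local Open Scope ring_scope.
Set Implicit Arguments.
Unset Strict Implicit.
Unset Printing Implicit Defensive.

(** * Irreducible factors over a field *)

(** Working with m and m^2 means that f never has to be factored mod p. The two identities leave one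
    gap: for p dividing N, the number N M L vanishes mod p, so the derivative no longer puts L in m.
    There f is (x^(N/p) + 1)^p mod p, and expanding x^N around x^(N/p) = -1 modulo m^2 replaces the
    derivative. The fields are told apart by a nilpotent: if f_b' = a Phi^2 mod p, then (a
    Phi)(theta') is a nonzero nilpotent of Z[theta']/p, whereas Z[theta]/p is reduced. For the class
    number no general product of ideals is set up. Multiplication by P^k = (M^k, 1 + sqrt delta) is
    an explicit operation on ideals, and the group law gives way to an action on a finite set.
    Freeness then needs an arbitrary ideal J to be cancelled from P^k J ~ J, so every ideal is shown
    to be invertible by means of its conjugate. The limit k <= n is M^k <= t, the range in which t +
    sqrt(t^2 + 1), a unit of norm -1, forces small norms to be squares; the remaining k are reached
    by replacing k with 2n - k. *)

Section IrreducibleFactors.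
Variable F : fieldType.
Implicit Types phi q r : {poly F}.

Lemma irreducible_coprimep phi q :
  irreducible_poly phi -> ~~ (phi %| q) -> coprimep phi q.
Proof.
move=> ip; apply: contraR => sg.
have /eqp_dvdl <- : gcdp phi q %= phi by apply: ip.2; rewrite ?dvdp_gcdl.
exact: dvdp_gcdr.
Qed.

Lemma irred_dvd_mul phi q r :
  irreducible_poly phi -> phi %| q * r -> phi %| q \/ phi %| r.
Proof.
move=> ip d; case: (boolP (phi %| q)) => [|nd]; [by left | right].
by rewrite -(Gauss_dvdpr r (irreducible_coprimep ip nd)).
Qed.

Lemma irred_dvd_exp phi q n :
  irreducible_poly phi -> phi %| q ^+ n -> phi %| q.
Proof.
move=> ip; elim: n => [|n IH].
  by rewrite expr0 dvdp1 => /eqP s1; have := ip.1; rewrite s1.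
by rewrite exprS => /(irred_dvd_mul ip) [].
Qed.

Lemma irred_divisor q : (1 < size q)%N ->
  exists2 phi, irreducible_poly phi & phi %| q.
Proof.
have [n] := ubnP (size q); elim: n q => // n IH q sn s1.
have [irr|/existsNP [r /not_implyP [sr /not_implyP [dr ne]]]] :=
  pselect (forall r : {poly F}, size r != 1%N -> r %| q -> r %= q).
  by exists q => //; split.
have q0 : q != 0 by rewrite -size_poly_gt0; apply: ltn_trans s1.
have r0 : r != 0 by apply: contraTneq dr => ->; rewrite dvd0p.
have sr1 : (1 < size r)%N.
  by move: sr r0; rewrite -size_poly_gt0; case: (size r) => [|[]].
have lt : (size r < size q)%N.
  rewrite ltn_neqAle dvdp_leq // andbT; apply/negP => e; apply: ne.
  by rewrite -(dvdp_size_eqp dr).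
have [|phi ip d] := IH r _ sr1; first by apply: leq_trans lt _.
by exists phi => //; apply: dvdp_trans d dr.
Qed.

(** Separability makes F[x]/(f) reduced. An irreducible factor of e = f / gcd(f, G) would divide G,
    hence the gcd as well, but e and the gcd are coprime. *)
Lemma coprimep_dvd_sqr (f G : {poly F}) : f != 0 ->
  coprimep f f^`() -> f %| G ^+ 2 -> f %| G.
Proof.
move=> f0 cop fG.
have sep : separable_poly f by rewrite unlock.
have /dvdpP [e ef] := dvdp_gcdl f G.
have [se|se] := leqP (size e) 1.
  have e0 : e`_0 != 0.
    by apply: contraNneq f0 => e0; rewrite ef (size1_polyC se) e0 polyC0 mul0r.
  by rewrite ef (size1_polyC se) mul_polyC dvdpZl // dvdp_gcdr.
have [phi ip de] := irred_divisor se.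
have dG : phi %| G.
  by apply: (irred_dvd_exp (n := 2) ip); apply: dvdp_trans fG; rewrite ef dvdp_mulr.
have : coprimep e (gcdp f G) by apply: (separable_coprime sep); rewrite -ef.
move/coprimepP => /(_ phi de); rewrite dvdp_gcd dG ef dvdp_mulr // => /(_ isT).
by move/eqp_size; rewrite size_poly1 => s1; have := ip.1; rewrite s1.
Qed.

End IrreducibleFactors.

(** * Dedekind's criterion *)

Definition evz (z : algC) : {poly int} -> algC :=
  horner_eval z \o map_poly intr.

HB.instance Definition _ (z : algC) :=
  GRing.RMorphism.copy (evz z) (horner_eval z \o map_poly intr).

Lemma evzE z P : evz z P = (map_poly intr P).[z].
Proof. by []. Qed.

Lemma evzC z (c : int) : evz z c%:P = c%:~R.
Proof. by rewrite evzE map_polyC hornerC. Qed.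

Lemma evzX z : evz z 'X = z.
Proof. by rewrite evzE map_polyX hornerX. Qed.

Lemma evz_ratr z P : evz z P = (map_poly ratr (map_poly intr P : {poly rat})).[z].
Proof.
rewrite evzE -map_poly_comp /=; congr (_.[_]); apply: eq_map_poly => x /=.
by rewrite ratr_int.
Qed.

Lemma evzB_dvd f z P Q q : croot f z -> P = Q + q * f -> evz z P = evz z Q.
Proof.
move=> /rootP fz ->; rewrite rmorphD rmorphM /=.
by rewrite [evz z f]evzE fz mulr0 addr0.
Qed.

Lemma size_map_intr (R : numDomainType) (P : {poly int}) :
  size (map_poly intr P : {poly R}) = size P.
Proof. by apply: size_map_inj_poly => //; exact: intr_inj. Qed.

Lemma map_intr_eq0 (R : numDomainType) (P : {poly int}) :
  (map_poly intr P == 0 :> {poly R}) = (P == 0).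
Proof. by rewrite -!size_poly_eq0 size_map_intr. Qed.

Lemma coprimeQ_of_nroot (f : {poly int}) (z : algC) (q : {poly rat}) :
  irreducibleQ f -> croot f z -> (map_poly ratr q).[z] != 0 ->
  coprimep (map_poly intr f) q.
Proof.
move=> irf fz qz; apply: irreducible_coprimep => //; apply: contraNN qz => /dvdpP [r ->].
by rewrite rmorphM hornerM -evz_ratr evzE (rootP fz) mulr0.
Qed.

Lemma coprimeQ_of_small (f : {poly int}) (q : {poly rat}) :
  irreducibleQ f -> q != 0 -> (size q < size f)%N ->
  coprimep (map_poly intr f) q.
Proof.
move=> irf q0 sq; apply: irreducible_coprimep => //; apply/negP.
by move=> /(dvdp_leq q0); rewrite size_map_intr leqNgt sq.
Qed.

Lemma evz_small_eq0 f z (P : {poly int}) :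
  irreducibleQ f -> croot f z -> (size P < size f)%N -> evz z P = 0 -> P = 0.
Proof.
move=> irf fz sP Pz; apply/eqP; apply/negPn/negP => P0.
have : coprimep (map_poly intr f) (map_poly intr P : {poly rat}).
  by apply: coprimeQ_of_small; rewrite ?map_intr_eq0 ?size_map_intr.
case/Bezout_eq1_coprimepP => -[u v] /= /(congr1 (fun p => (map_poly ratr p).[z])).
rewrite !rmorphD !rmorphM /= hornerD !hornerM -!evz_ratr Pz [evz z f]evzE (rootP fz).
by rewrite !mulr0 addr0 rmorph1 hornerC => /eqP; rewrite eq_sym oner_eq0.
Qed.

Lemma rmodp_monicE (f P : {poly int}) : f \is monic ->
  exists Q R, P = R + Q * f /\ (size R < size f)%N.
Proof.
move=> mf; exists (Pdiv.CommonRing.rdivp P f), (Pdiv.CommonRing.rmodp P f); split.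
  by rewrite addrC; exact: Pdiv.RingMonic.rdivp_eq.
by apply: Pdiv.CommonRing.ltn_rmodpN0; exact: monic_neq0.
Qed.

Lemma evz_eq0 f z (P : {poly int}) : f \is monic ->
  irreducibleQ f -> croot f z -> evz z P = 0 -> exists Q, P = Q * f.
Proof.
move=> mf irf fz Pz; have [Q [R [e sR]]] := rmodp_monicE P mf.
exists Q; rewrite e.
rewrite (_ : R = 0) ?add0r //; apply: (evz_small_eq0 irf fz sR).
by rewrite -(evzB_dvd fz e).
Qed.

Lemma adjoinQ_evz z P : adjoinQ z (evz z P).
Proof.
exists (map_poly intr P), 1; rewrite rmorph1 hornerC oner_eq0 divr1; split => //.
by rewrite evz_ratr.
Qed.

(** A Bezout relation between f and the denominator q turns 1/q(z) into a polynomial in z; only an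
    integer denominator then remains. *)
Lemma adjoinQ_clear_denom f z x : irreducibleQ f -> croot f z ->
  adjoinQ z x -> exists P (d : nat), (0 < d)%N /\ x * d%:R = evz z P.
Proof.
move=> irf fz [p [q [q0 ->]]].
have /Bezout_eq1_coprimepP [[u v] /= uv] := coprimeQ_of_nroot irf fz q0.
have iq : ((map_poly ratr q).[z])^-1 = (map_poly ratr v).[z].
  apply: (mulIf q0); rewrite mulVf //.
  have := congr1 (fun r => (map_poly ratr r).[z]) uv.
  rewrite rmorphD /= !rmorphM rmorph1 hornerD !hornerM hornerC /=.
  by rewrite -evz_ratr evzE (rootP fz) mulr0 add0r.
rewrite iq -hornerM -rmorphM /=; move: (p * v) => r.
have [P [a a0 rE]] := rat_poly_scale r.
exists ((sgz a)%:P * P), `|a|%N; split; first by rewrite absz_gt0.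
rewrite rmorphM /= evzC rE linearZ /= hornerZ -evz_ratr rmorphV ?unitfE ?intr_eq0 //=.
rewrite ratr_int mulrAC; congr (_ * _).
have a0' : a%:~R != 0 :> algC by rewrite intr_eq0.
by apply: (mulfI a0'); rewrite mulVKf // -intrM mulrC -abszEsg.
Qed.

Lemma Aint_monic_root x : x \in Aint ->
  exists P : {poly int}, P \is monic /\ evz x P = 0.
Proof.
rewrite unfold_in => /floorpP [P eP]; exists P; split.
  have := minCpoly_monic x; rewrite eP !monicE lead_coef_map_inj //; last exact: intr_inj.
  by rewrite (eqr_int _ _ 1).
by rewrite evzE -eP; apply/rootP/root_minCpoly.
Qed.

Section ModP.
Variable p : nat.
Hypothesis pp : prime p.

Definition redp (P : {poly int}) : {poly 'F_p} := map_poly intr P.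

HB.instance Definition _ := GRing.RMorphism.copy redp (map_poly intr).

Lemma redpN P : redp (- P) = - redp P.
Proof. by apply/polyP => i; rewrite coefN !coef_map /= coefN rmorphN. Qed.

Lemma redpB P Q : redp (P - Q) = redp P - redp Q.
Proof. by rewrite -redpN -rmorphD. Qed.

Lemma redp_surj q : exists P, redp P = q.
Proof.
exists (map_poly (fun a : 'F_p => (a : nat)%:Z) q).
rewrite /redp -map_poly_comp_id0 //; apply/polyP => i.
by rewrite coef_map_id0 //= -[RHS]natr_Zp.
Qed.

Lemma redp_eq0 P : redp P = 0 -> exists Q, P = p%:R * Q.
Proof.
move=> /polyP P0; exists (\poly_(i < size P) (P`_i %/ p)%Z).
apply/polyP => i; rewrite -[p%:R]polyC_natr mul_polyC coefZ coef_poly.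
case: ltnP => si; last by rewrite mulr0 nth_default.
have := P0 i; rewrite coef_map coef0 => /eqP; rewrite -(dvdz_pcharf (pchar_Fp pp)).
by move=> /divzK {1}<-; rewrite mulrC natz.
Qed.

Lemma redp_p : redp p%:R = 0.
Proof. by rewrite rmorph_nat -polyC_natr pchar_Fp_0 // polyC0. Qed.

Lemma redp_nat_unit (n : nat) : coprime p n -> exists c : 'F_p, c != 0 /\ redp n%:R = c%:P.
Proof.
move=> cpn; exists n%:R; rewrite rmorph_nat -polyC_natr; split => //.
by rewrite -unitfE unitFpE.
Qed.

Lemma redp_monic P : P \is monic -> redp P \is monic.
Proof. exact: monic_map. Qed.

(* Homogenising a monic equation for x = B(z)/A(z) gives B^k in (A) mod f. *)
Lemma integral_dvd f z A B x (phi : {poly 'F_p}) :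
  f \is monic -> irreducibleQ f -> croot f z -> x \in Aint ->
  evz z A * x = evz z B -> irreducible_poly phi ->
  phi %| redp f -> phi %| redp A -> phi %| redp B.
Proof.
move=> mf irf fz /Aint_monic_root [P [mP Px]] e ip df dA.
have [k sP] : exists k, size P = k.+1.
  by exists (size P).-1; rewrite prednK // size_poly_gt0 monic_neq0.
pose H := \sum_(i < k.+1) (P`_i)%:P * B ^+ i * A ^+ (k - i).
have Hz : evz z H = 0.
  rewrite rmorph_sum /=.
  transitivity (evz z A ^+ k * evz x P); last by rewrite Px mulr0.
  rewrite [evz x P]evzE (@horner_coef_wide _ k.+1) ?size_map_intr ?sP //.
  rewrite big_distrr /=; apply: eq_bigr => i _.
  rewrite !rmorphM !rmorphXn /= evzC -e coef_map exprMn.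
  have -> : evz z A ^+ k = evz z A ^+ i * evz z A ^+ (k - i).
    by rewrite -exprD subnKC // leq_ord.
  by rewrite /=; ring.
have [Q HQ] := evz_eq0 mf irf fz Hz.
have : phi %| redp H by rewrite HQ rmorphM dvdp_mull.
rewrite rmorph_sum big_ord_recr /= subnn expr0 mulr1 dvdp_addr; last first.
  apply: (big_ind (fun q => phi %| q)) => [||i _]; rewrite ?dvdp0 //.
    by move=> u v du dv; rewrite dvdp_addl.
  rewrite !rmorphM !rmorphXn /= dvdp_mull //.
  by rewrite -subnSK ?ltn_ord //= exprS dvdp_mulr.
move/monicP: mP; rewrite lead_coefE sP /= => ->; rewrite mul1r rmorphXn.
exact: irred_dvd_exp.
Qed.

End ModP.

Lemma monic_natM_eq1 (n : nat) (H : {poly int}) : n%:R * H \is monic -> n = 1%N.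
Proof.
move/monicP; rewrite -polyC_natr mul_polyC lead_coefZ natz => /(congr1 absz)/eqP.
by rewrite abszM /= muln_eq1 => /andP[/eqP].
Qed.

Lemma croot_exists (f : {poly int}) : (1 < size f)%N -> exists z, croot f z.
Proof.
move=> sf; apply/closed_rootP; rewrite size_map_intr.
by case: (size f) sf => [|[]].
Qed.

Lemma croot_Aint f z : f \is monic -> croot f z -> z \in Aint.
Proof.
move=> mf fz; apply: (@root_monic_Aint (map_poly intr f)) => //.
  exact: monic_map.
by apply/polyOverP => i; rewrite coef_map /= intr_int.
Qed.

Lemma evz_Aint z P : z \in Aint -> evz z P \in Aint.
Proof.
move=> zA; rewrite evzE; apply: rpred_horner => //.
by apply/polyOverP => i; rewrite coef_map /= Aint_int.
Qed.

Section SquareIdeal.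
Variable p : nat.
Hypothesis pp : prime p.

Lemma in_maxP (Phi P : {poly int}) :
  redp p Phi %| redp p P -> exists a b, P = a * Phi + p%:R * b.
Proof.
case/dvdpP => q e; have [a aq] := redp_surj q.
have [|b eb] := @redp_eq0 p pp (P - a * Phi); first by rewrite redpB rmorphM /= aq e subrr.
by exists a, b; rewrite -eb addrC subrK.
Qed.

Lemma in_max_lin (Phi a b : {poly int}) : redp p Phi %| redp p (a * Phi + p%:R * b).
Proof. by rewrite rmorphD !rmorphM /= redp_p // mul0r addr0 dvdp_mull. Qed.

(* Membership in the square of the ideal (p, Phi). *)
Definition in_sq (Phi P : {poly int}) : Prop :=
  exists a b c, P = a * Phi ^+ 2 + p%:R * b * Phi + p%:R ^+ 2 * c.

Lemma in_sqM (Phi P Q : {poly int}) :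
  redp p Phi %| redp p P -> redp p Phi %| redp p Q -> in_sq Phi (P * Q).
Proof.
move=> /in_maxP [a [b ->]] /in_maxP [c [d ->]].
by exists (a * c), (a * d + b * c), (b * d); ring.
Qed.

Lemma in_sqD (Phi P Q : {poly int}) : in_sq Phi P -> in_sq Phi Q -> in_sq Phi (P + Q).
Proof.
move=> [a [b [c ->]]] [d [e [g ->]]].
by exists (a + d), (b + e), (c + g); ring.
Qed.

Lemma in_sq_mull (Phi P Q : {poly int}) : in_sq Phi P -> in_sq Phi (Q * P).
Proof.
move=> [a [b [c ->]]].
by exists (Q * a), (Q * b), (Q * c); ring.
Qed.

Lemma in_sqB (Phi P Q : {poly int}) : in_sq Phi P -> in_sq Phi Q -> in_sq Phi (P - Q).
Proof.
by move=> sP sQ; rewrite -mulN1r; apply: in_sqD => //; apply: in_sq_mull.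
Qed.

Lemma in_sq_max (Phi P : {poly int}) : in_sq Phi P -> redp p Phi %| redp p P.
Proof.
move=> [a [b [c ->]]].
rewrite [X in _ %| redp p X](_ : _ = (a * Phi + p%:R * b) * Phi + p%:R * (p%:R * c));
  last by ring.
exact: in_max_lin.
Qed.

Lemma in_sq_deriv (Phi P : {poly int}) : in_sq Phi P -> redp p Phi %| redp p P^`().
Proof.
move=> [a [b [c ->]]]; rewrite -!polyC_natr -polyC_exp [Phi ^+ 2]expr2.
rewrite !derivD !derivM !derivC polyC_exp !polyC_natr.
set a' := a^`(); set b' := b^`(); set c' := c^`(); set f' := Phi^`().
rewrite [X in _ %| redp p X](_ : _ = (a' * Phi + a * (f' + f')) * Phi +
   p%:R * (b' * Phi + b * f' + p%:R * c')); last by ring.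
exact: in_max_lin.
Qed.

(** Reducing mod p gives a Phi^2 = 0, so p divides a and the whole relation can be divided by p. *)
Lemma in_sq_p (Phi P : {poly int}) : redp p Phi != 0 ->
  in_sq Phi (p%:R * P) -> redp p Phi %| redp p P.
Proof.
move=> F0 [a [b [c e]]].
have a0 : redp p a = 0.
  have := congr1 (redp p) e; rewrite !rmorphD !rmorphM /= redp_p //.
  rewrite !mul0r !addr0 => /esym/eqP.
  by rewrite !mulf_eq0 (negPf F0) !orbF => /eqP.
have [a' ea] := redp_eq0 pp a0.
have -> : P = (a' * Phi + b) * Phi + p%:R * c.
  have p0 : (p%:R : {poly int}) != 0 by rewrite -polyC_natr polyC_eq0 pnatr_eq0 -lt0n prime_gt0.
  by apply: (mulfI p0); rewrite e ea; ring.
exact: in_max_lin.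
Qed.

(* Dedekind's criterion, with Uchida's formulation of the hypothesis. *)
Lemma integral_div_prime f z G x :
  f \is monic -> irreducibleQ f -> croot f z -> x \in Aint ->
  p%:R * x = evz z G ->
  (forall Phi, irreducible_poly (redp p Phi) -> redp p Phi %| redp p f -> ~ in_sq Phi f) ->
  exists H, x = evz z H.
Proof.
move=> mf irf fz xA ex max.
have p0 : p%:R != 0 :> algC by rewrite pnatr_eq0 -lt0n prime_gt0.
have zA := croot_Aint mf fz.
have ep : p%:R = evz z p%:R by rewrite rmorph_nat.
case: (boolP (redp p f %| redp p G)) => [|nd].
  case/in_maxP => a [b eG]; exists b; apply: (mulfI p0).
  rewrite ex ep -rmorphM /=.
  by apply: (evzB_dvd fz); rewrite eG addrC; first done.
exfalso.
have f0 : redp p f != 0 by apply: monic_neq0; exact: redp_monic.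
(* Mod p, f = w d with w not constant, because f does not divide G. Take an irreducible factor phi
   of w = w' phi: then g = w' d is f / phi, and Bezout writes it as a combination of G and f. *)
set d := gcdp (redp p G) (redp p f).
have [w ew] : exists w, redp p f = w * d by apply/dvdpP; exact: dvdp_gcdr.
have sw : (1 < size w)%N.
  rewrite ltnNge; apply/negP => sw; case/negP: nd.
  apply: dvdp_trans (dvdp_gcdl _ (redp p f)); rewrite -/d ew.
  move: f0; rewrite ew; rewrite (size1_polyC sw) => f0.
  rewrite mul_polyC dvdpZl //; apply: contraNneq f0 => ->.
  by rewrite polyC0 mul0r.
have [phi ip /dvdpP [w' ew']] := irred_divisor sw.
have [Phi ePhi] := redp_surj phi.
have [[u1 u2] /= /eqpP [[c1 c2] /= /andP[c10 c20] ec]] := Bezoutp (redp p G) (redp p f).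
have ed : d = (c2^-1 * c1) *: (u1 * redp p G + u2 * redp p f).
  by rewrite -scalerA ec scalerA mulVf // scale1r.
have [U eU] := redp_surj ((c2^-1 * c1) *: (w' * u1)).
have [V eV] := redp_surj ((c2^-1 * c1) *: (w' * u2)).
have [g eg] := redp_surj (w' * d).
have [|W eW] := @redp_eq0 p pp (g - U * G - V * f).
  rewrite !redpB !rmorphM /= eg eU eV ed -!mul_polyC; ring.
have [|F eF] := @redp_eq0 p pp (f - g * Phi).
  by rewrite redpB rmorphM /= eg ePhi ew ew'; ring.
have df : redp p Phi %| redp p f by rewrite ePhi ew ew' dvdp_mulr // dvdp_mull.
have iP : irreducible_poly (redp p Phi) by rewrite ePhi.
apply: (max Phi) => //.
(* This integral element satisfies p y = g(z), and also Phi(z) y = - F(z), since f = g Phi + p F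
   vanishes at z. *)
pose y := evz z U * x + evz z W.
have yA : y \in Aint by rewrite rpredD ?rpredM // evz_Aint.
have ey : evz z p%:R * y = evz z g.
  rewrite -ep /y mulrDr mulrCA ex ep -!rmorphM -rmorphD /=; apply/esym;
    apply: (@evzB_dvd f z _ _ V fz).
  by rewrite -eW; ring.
have ey2 : evz z Phi * y = evz z (- F).
  apply: (mulfI p0); rewrite mulrCA ep ey -!rmorphM /= mulrC.
  apply: (@evzB_dvd f z _ _ 1 fz); rewrite mulrN -eF; ring.
(* Integrality of y puts g in (p, Phi) by the first equation and F by the second, so f = g Phi + p F
   lies in the square of that ideal. *)
have : redp p Phi %| redp p g.
  by apply: (integral_dvd mf irf fz yA ey iP df); rewrite redp_p // dvdp0.
have : redp p Phi %| redp p (- F).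
  exact: (integral_dvd mf irf fz yA ey2 iP df).
rewrite redpN dvdpNr => /in_maxP [b [c eFF]] /in_maxP [a [e egg]].
exists a, (e + b), c.
have -> : f = g * Phi + p%:R * F by rewrite -eF; ring.
by rewrite eFF egg; ring.
Qed.

End SquareIdeal.

(** Induction on the denominator d: [integral_div_prime] cancels one prime factor of d at a time. *)
Lemma integers_eq_evz f z x :
  f \is monic -> irreducibleQ f -> croot f z ->
  (forall p Phi, prime p -> irreducible_poly (redp p Phi) ->
     redp p Phi %| redp p f -> ~ in_sq p Phi f) ->
  ring_of_integers (adjoinQ z) x -> exists H, x = evz z H.
Proof.
move=> mf irf fz max [Kx xA].
have [P [d [d0 e]]] := adjoinQ_clear_denom irf fz Kx.
have [n] := ubnP d; elim: n d P d0 e => // n IH d P d0 e dn.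
have [d1|d1] := leqP d 1.
  have dd : d = 1%N by lia.
  by exists P; rewrite -e dd mulr1.
have pp := pdiv_prime d1; set p := pdiv d in pp.
have [k ek] : exists k, d = (k * p)%N.
  by exists (d %/ p)%N; rewrite divnK // pdiv_dvd.
have p1 := prime_gt1 pp.
have [||Phi|H eH] := @integral_div_prime p pp f z P (x * k%:R) mf irf fz.
- by rewrite rpredM // rpred_nat.
- by rewrite -e ek natrM; ring.
- exact: max.
have k0 : (0 < k)%N by move: d0; rewrite ek muln_gt0 => /andP[].
have kd : (k < d)%N by rewrite ek -[X in (X < _)%N]muln1 ltn_pmul2l.
by apply: (IH k H) => //; exact: leq_trans kd dn.
Qed.

Lemma monogenic_of_maximal (f : {poly int}) :
  f \is monic -> (2 < size f)%N -> irreducibleQ f ->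
  (forall p Phi, prime p -> irreducible_poly (redp p Phi) ->
     redp p Phi %| redp p f -> ~ in_sq p Phi f) -> monogenic f.
Proof.
move=> mf sf irf max; split => // z fz.
have sf' : (size f).-1.+1 = size f by rewrite prednK //; lia.
have evw (P : {poly int}) : (size P < size f)%N ->
    evz z P = \sum_(i < (size f).-1) (P`_i)%:~R * z ^+ i.
  move=> sP; rewrite evzE (@horner_coef_wide _ (size f).-1) ?size_map_intr; last by lia.
  by apply: eq_bigr => i _; rewrite coef_map.
split.
  move=> i; split; last by rewrite rpredX // (croot_Aint mf).
  by have := adjoinQ_evz z 'X^i; rewrite rmorphXn /= evzX.
move=> x /(integers_eq_evz mf irf fz max) [H eH].
have [Q [R [eR sR]]] := rmodp_monicE H mf.
exists [ffun i : 'I__ => R`_i]; split.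
  rewrite eH (evzB_dvd fz eR) evw //.
  by apply: eq_bigr => i _; rewrite ffunE.
move=> c ec; apply/ffunP => i; rewrite ffunE.
(* A rival family of coordinates, read as a polynomial of degree below that of f, so that
   [evz_small_eq0] gives uniqueness. *)
pose C := \poly_(j < (size f).-1) (if insub j is Some i then c i else 0).
have sC : (size C < size f)%N by rewrite -sf' ltnS size_poly.
have cC j : C`_(j : 'I_(size f).-1) = c j.
  by rewrite coef_poly ltn_ord insubT //= => ?; congr (c _); exact: val_inj.
have : R - C = 0.
  apply: (evz_small_eq0 irf fz).
    by rewrite (leq_ltn_trans (size_polyD _ _)) // size_polyN gtn_max sR sC.
  rewrite rmorphB /= (evw C) // -(evzB_dvd fz eR) -eH ec -sumrB big1 // => j _.
  by rewrite cC subrr.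
by move/eqP; rewrite subr_eq0 => /eqP ->; rewrite cC.
Qed.

Lemma monogenic_integers f z x : monogenic f -> croot f z ->
  ring_of_integers (adjoinQ z) x -> exists H, x = evz z H /\ (size H < size f)%N.
Proof.
move=> [mf sf irf bas] fz xK; have [_ /(_ x xK) [c [ec _]]] := bas z fz.
pose C := \poly_(j < (size f).-1) (if insub j is Some i then c i else 0).
have sC : (size C <= (size f).-1)%N by rewrite size_poly.
exists C; split; last by rewrite (leq_ltn_trans sC) // ltn_predL (ltn_trans _ sf).
rewrite ec evzE (@horner_coef_wide _ (size f).-1) ?size_map_intr //.
apply: eq_bigr => i _; rewrite coef_map coef_poly ltn_ord insubT //= => h.
by congr ((c _)%:~R * _); exact: val_inj.
Qed.

Lemma Aint_root_monic (P : {poly algC}) x : P \is monic -> root P x ->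
  (forall i, P`_i \in Aint) -> x \in Aint.
Proof.
move=> mP Px PA.
have [|q mq qx] := @integral_root_monic _ _ (intr : int -> algC) x P mP Px.
  move=> a /(nthP 0) [i _ <-]; have [Q [mQ Qa]] := Aint_monic_root (PA i).
  by exists Q => //; apply/rootP; rewrite -evzE.
apply: root_monic_Aint qx _ _; first exact: monic_map.
by apply/polyOverP => i; rewrite coef_map /= intr_int.
Qed.

(* (a Phi)(z)/p is integral, being a root of Y^2 + b Y + a c. *)
Lemma not_monogenic_of_sq (p : nat) (f a b c Phi : {poly int}) :
  prime p -> f = a * Phi ^+ 2 + p%:R * b * Phi + p%:R ^+ 2 * c ->
  a * Phi \is monic -> (size (a * Phi)%R < size f)%N -> ~ monogenic f.
Proof.
move=> pp ef maP saP mon; have [mf sf irf _] := mon.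
have [z fz] := @croot_exists f (ltnW sf).
have zA := croot_Aint mf fz.
have p0 : p%:R != 0 :> algC by rewrite pnatr_eq0 -lt0n prime_gt0.
pose y := evz z (a * Phi) / p%:R.
have py : p%:R * y = evz z (a * Phi) by rewrite mulrCA mulfV // mulr1.
have yeq : y ^+ 2 + evz z b * y + evz z (a * c) = 0.
  apply: (mulfI p0); apply: (mulfI p0).
  rewrite mulr0 mulr0; transitivity (evz z (a * f)).
    rewrite (_ : a * f = (a * Phi) ^+ 2 + p%:R * b * (a * Phi) + p%:R ^+ 2 * (a * c));
      last by rewrite ef; ring.
    move: (a * Phi) (a * c) @y py {maP saP} => w v y py.
    by rewrite !rmorphD !rmorphM /= !rmorph_nat -py; ring.
  by rewrite rmorphM /= [evz z f]evzE (rootP fz) mulr0.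
have yA : y \in Aint.
  apply: (@Aint_root_monic (('X + (evz z b)%:P) * 'X + (evz z (a * c))%:P)).
  - rewrite monicE lead_coefDl ?(monicP (monicMr _ _)) ?lead_coefM ?lead_coefX ?mulr1.
      by rewrite -monicE monicXaddC.
    by rewrite size_mulX ?monic_neq0 ?monicXaddC // size_XaddC size_polyC; case: eqP.
  - by apply/rootP; rewrite hornerMXaddC hornerD hornerX hornerC -yeq; ring.
  - move=> i; rewrite coefD coefMX coefC coefD coefX coefC.
    by case: i => [|[|[|i]]]; rewrite /= ?add0r ?addr0 ?evz_Aint.
have [|H [eH sH]] := @monogenic_integers f z y mon fz.
  split => //.
  rewrite /y; exists (map_poly intr (a * Phi)), p%:R.
  by rewrite rmorph_nat -polyC_natr hornerC -evz_ratr.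
(* Both polynomials have degree below that of f and the same value p y at z; but a monic polynomial
   is not a multiple of p. *)
have : a * Phi - p%:R * H = 0.
  apply: (evz_small_eq0 irf fz).
    rewrite (leq_ltn_trans (size_polyD _ _)) // size_polyN gtn_max saP /=.
    by rewrite -polyC_natr mul_polyC (leq_ltn_trans (size_scale_leq _ _)).
  by rewrite rmorphB [X in _ - X]rmorphM /= -py rmorph_nat eH subrr.
move/eqP; rewrite subr_eq0 => /eqP e.
by rewrite e in maP; move: pp; rewrite (monic_natM_eq1 maP).
Qed.

(** * Monogenicity of the trinomials *)

(** The binomial expansion cut off at second order. It serves for powers of M^b x = L - 1 and for
    p-th powers of x^(N/p). *)
Lemma expr_sub1_mod_sq (R : comRingType) (L : R) n :
  exists Q, (L - 1) ^+ n = (-1) ^+ n * (1 - n%:R * L) + L ^+ 2 * Q.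
Proof.
elim: n => [|n [Q IH]]; first by exists 0; rewrite !expr0; ring.
exists ((-1) ^+ n.+1 * n%:R + (L - 1) * Q); rewrite exprS IH.
by rewrite -natr1 !exprS; ring.
Qed.

(** Supplies the side conditions of [not_monogenic_of_sq]: f - r = (a Phi) Phi is monic of the
    degree of f, and Phi is monic and not constant. *)
Lemma monic_factor_of_sq (f a r Phi : {poly int}) :
  f \is monic -> Phi \is monic -> (1 < size Phi)%N -> f = a * Phi ^+ 2 + r ->
  (size r < size f)%N -> a * Phi \is monic /\ (size (a * Phi)%R < size f)%N.
Proof.
move=> mf mP sP ef sr.
have e : a * Phi * Phi = f - r by rewrite [in RHS]ef addrK expr2 mulrA.
have sr' : (size (- r) < size f)%N by rewrite size_polyN.
have m : a * Phi \is monic.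
  by rewrite -(monicMr _ mP) e monicE lead_coefDl // (monicP mf).
have -> : size f = (size (a * Phi)%R + size Phi).-1.
  by rewrite -(size_polyDl sr') -e (@size_Mmonic _ (a * Phi)) ?monic_neq0.
have := size_poly_gt0 (a * Phi); rewrite monic_neq0 //.
by move: (size (a * Phi)) (size Phi) sP => x y; split => //; lia.
Qed.

Section MaximalIdeal.
Variables (p : nat) (Phi : {poly int}).
Hypotheses (pp : prime p) (iPhi : irreducible_poly (redp p Phi)).

(** Membership in m = (p, Phi), a maximal ideal because Phi is irreducible mod p. *)
Definition in_max (P : {poly int}) := redp p Phi %| redp p P.

Lemma in_maxD P Q : in_max P -> in_max Q -> in_max (P + Q).
Proof. by move=> mP mQ; rewrite /in_max rmorphD /= dvdp_addl. Qed.

Lemma in_maxB P Q : in_max P -> in_max Q -> in_max (P - Q).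
Proof. by move=> mP mQ; rewrite /in_max redpB dvdp_subl. Qed.

Lemma in_maxMl P Q : in_max Q -> in_max (P * Q).
Proof. by move=> mQ; rewrite /in_max rmorphM dvdp_mull. Qed.

Lemma in_maxMr P Q : in_max P -> in_max (P * Q).
Proof. by move=> mP; rewrite /in_max rmorphM dvdp_mulr. Qed.

Lemma in_max_mul P Q : in_max (P * Q) -> in_max P \/ in_max Q.
Proof. by rewrite /in_max rmorphM; exact: irred_dvd_mul. Qed.

Lemma in_max_exp P n : in_max (P ^+ n) -> in_max P.
Proof. by rewrite /in_max rmorphXn; exact: irred_dvd_exp. Qed.

Lemma in_max_1 : ~ in_max 1.
Proof.
rewrite /in_max rmorph1 dvdp1 => /eqP s; have := iPhi.1; by rewrite s.
Qed.

Lemma in_max_dvd n : (p %| n)%N -> in_max n%:R.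
Proof.
by case/dvdnP => k ->; rewrite /in_max natrM rmorphM /= [redp p p%:R]redp_p // mulr0 dvdp0.
Qed.

Lemma in_max_nat n : in_max n%:R -> (p %| n)%N.
Proof.
move=> m; apply/negPn/negP; rewrite -prime_coprime // => cp.
have [c [c0 e]] := redp_nat_unit pp cp.
have c0' : c%:P != 0 :> {poly 'F_p} by rewrite polyC_eq0.
move: m; rewrite /in_max e => /(dvdp_leq c0').
by rewrite size_polyC c0 leqNgt iPhi.1.
Qed.

Lemma in_max_natM n P : ~~ (p %| n)%N -> in_max (n%:R * P) -> in_max P.
Proof. by move=> nd /in_max_mul [/in_max_nat|//]; rewrite (negPf nd). Qed.

(** The form in which squarefreeness is used. Either n is invertible mod p, or n = k p with k
    invertible mod p, and [in_sq_p] removes the factor p. *)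
Lemma in_sq_natM n P : ~~ (p ^ 2 %| n)%N -> in_sq p Phi (n%:R * P) -> in_max P.
Proof.
move=> nd sq; case: (boolP (p %| n)%N) => [/dvdnP [k e]|nd']; last first.
  by apply: (in_max_natM nd'); exact: in_sq_max.
apply: (@in_max_natM k).
  by apply: contra nd => kd; rewrite e expnS expn1 dvdn_pmul2r // prime_gt0.
apply: in_sq_p => //; first exact: irredp_neq0.
by move: sq; rewrite e natrM -mulrA mulrCA.
Qed.

End MaximalIdeal.

Section Trinomial.
Variables M b : nat.
Let N := M.+1.
Let f := trinomial N b.
Let L : {poly int} := M%:R ^+ b * 'X + 1.
(** With this notation delta is [E + 1]. *)
Let E := (M ^ (b * N))%N.

Lemma trinomialE : f = 'X^N - N%:R * M%:R ^+ b * 'X - M%:R.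
Proof.
rewrite /f /trinomial (_ : N%:Z - 1 = M%:R :> int); last by rewrite /N; lia.
by rewrite polyCM polyC_exp -[N%:Z]natz !polyC_natr.
Qed.

Lemma trinomial_monic : (0 < M)%N -> f \is monic /\ size f = N.+1.
Proof.
move=> M0; have s : (size (- (N%:R * M%:R ^+ b * 'X) - M%:R : {poly int})%R < size ('X^N : {poly int})%R)%N.
  rewrite size_polyXn ltnS (leq_trans (size_polyD _ _)) // geq_max !size_polyN.
  rewrite -natrX -natrM -!polyC_natr mul_polyC (leq_trans (size_scale_leq _ _)) ?size_polyX //.
  by rewrite (leq_trans (size_polyC_leq1 _)).
rewrite trinomialE -addrA; split; last by rewrite size_polyDl // size_polyXn.
by rewrite monicE lead_coefDl // lead_coefXn.
Qed.

Lemma trinomial_deriv : 'X * f^`() - N%:R * f = N%:R * M%:R * L.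
Proof.
rewrite trinomialE -natrX -natrM !derivB derivXn -!polyC_natr derivM !derivC derivX.
rewrite mul0r add0r subr0 !polyC_natr natrM natrX -[N.-1]/M /L -mulr_natl [in N%:R * (_ - _ - _)]/N exprS.
by rewrite -[N]addn1 !natrD; ring.
Qed.

(* M^(bN) X^N = (M^b X)^N = (L - 1)^N. *)
Lemma trinomial_mod_sq : ~~ odd N -> exists Q,
  E%:R * f = (E + 1)%:R * (1 - N%:R * L) + L ^+ 2 * Q.
Proof.
move=> oN; have [Q] := expr_sub1_mod_sq L N.
rewrite -signr_odd (negPf oN) expr0 mul1r addrK => eQ; exists Q.
move: eQ; rewrite exprMn -exprM -natrX -/E => eQ.
rewrite trinomialE; have -> : E%:R * ('X^N - N%:R * M%:R ^+ b * 'X - M%:R) =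
  E%:R * 'X^N - N%:R * E%:R * (L - 1) - M%:R * E%:R by rewrite /L; ring.
rewrite eQ -[N]addn1 !natrD; ring.
Qed.

(** Modulo a divisor q of delta, M is invertible and L is M^b (x + u), so [trinomial_mod_sq]
    exhibits a double root of f. The case q = p^2 refutes monogenicity, and q = p separates the
    fields. *)
Lemma trinomial_mod_sq_shift q : (1 < q)%N -> ~~ odd N -> (0 < M)%N ->
  (q %| E + 1)%N -> exists (u : int) a r,
  f = a * ('X + u%:P) ^+ 2 + q%:R * r /\ (size r < 3)%N.
Proof.
move=> q1 oN M0 qd; have [mf sf] := trinomial_monic M0.
have [Q eQ] := trinomial_mod_sq oN.
have [k ek] := dvdnP qd.
have cE : coprimez q E by rewrite coprimezE /= (coprime_dvdl qd) // addn1 coprimeSn.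
have [[w v] /= evw] := coprimezP _ _ cE.
(* u is the inverse of M^b mod q: v inverts E = M^b M^(b M), as N = M + 1. *)
pose u := v * (M%:Z ^+ (b * M)); pose Phi := 'X + u%:P : {poly int}.
have mPhi : Phi ^+ 2 \is monic by rewrite rpredX // monicXaddC.
have eP : w%:P * q%:R + v%:P * E%:R = 1 :> {poly int}.
  by rewrite -!polyC_natr -!polyCM -polyCD !natz evw.
have eL : L = M%:R ^+ b * Phi + q%:R * w%:P.
  rewrite /L -[X in _ + X = _]eP /Phi /u polyCM polyC_exp -[M%:Z]natz polyC_natr /E natrX mulnS exprD; ring.
have ek' : (E + 1)%:R = k%:R * q%:R :> {poly int} by rewrite ek natrM.
rewrite ek' in eQ.
pose c0 := w%:P * f + v%:P * k%:R * (1 - N%:R * L) +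
           v%:P * Q * (2 * M%:R ^+ b * Phi * w%:P + q%:R * w%:P ^+ 2).
(* Dividing the cofactor of q by Phi^2 moves its quotient into a and leaves r of degree at most
   1. *)
have [Q' [r [er sr]]] := rmodp_monicE c0 mPhi.
exists u, (v%:P * Q * M%:R ^+ b ^+ 2 + q%:R * Q'), r; split; last first.
  by move: sr; rewrite /Phi -(opprK u%:P) -polyCN size_exp_XsubC.
rewrite -/Phi; transitivity (v%:P * Q * M%:R ^+ b ^+ 2 * Phi ^+ 2 + q%:R * c0); last first.
  by rewrite er; ring.
transitivity (w%:P * q%:R * f + v%:P * (E%:R * f)).
  by rewrite mulrA -mulrDl eP mul1r.
by rewrite eQ /c0 eL; ring.
Qed.

Lemma trinomial_in_max p Phi : prime p -> irreducible_poly (redp p Phi) ->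
  (0 < b)%N -> (N = 2 %[mod 4])%N ->
  squarefree (N * M) -> squarefree (E + 1) ->
  redp p Phi %| redp p f -> ~ in_sq p Phi f.
Proof.
move=> pp ip b0 N4 sNM sE mf sf; rewrite -/(in_max p Phi f) in mf.
have p1 := prime_gt1 pp; have M0 : (0 < M)%N by rewrite /N in N4; lia.
have oN : ~~ odd N by rewrite /N in N4 *; lia.
have not_sq n k : squarefree k -> (n %| k)%N -> ~~ (p ^ 2 %| n)%N.
  move=> sk nk; apply/negP => d; have := sk p (dvdn_trans d nk); lia.
have eN : N%:R = M%:R + 1 :> {poly int} by rewrite -natr1.
have fE := trinomialE.
have mXsq P Q := @in_sqM p pp Phi P Q.
have [pM|npM] := boolP (p %| M)%N.
  have mM : in_max p Phi M%:R by apply: in_max_dvd.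
  (* Case p | M: f is x^N mod p. Once x is in m, every term of f except M lies in m^2, so M does
     too, which forces 1 into m. *)
  have mX : in_max p Phi 'X.
    apply: (@in_max_exp _ _ ip _ N).
    rewrite (_ : 'X^N = f + (N%:R * M%:R ^+ b * 'X + M%:R)); last by rewrite fE; ring.
    apply: in_maxD => //; apply: in_maxD => //; apply: in_maxMr; apply: in_maxMl.
    by rewrite -(prednK b0) exprS; apply: in_maxMr.
  apply: (@in_max_1 p Phi ip); apply: (@in_sq_natM _ _ pp ip M).
    by apply: (not_sq _ _ sNM); exact: dvdn_mull.
  have -> : M%:R * 1 = 'X * 'X^M - (N%:R * M%:R ^+ b.-1) * (M%:R * 'X) - f :> {poly int}.
    have eb : M%:R ^+ b = M%:R * M%:R ^+ b.-1 :> {poly int} by rewrite -exprS prednK.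
    by rewrite fE eb [in 'X^N]exprS; ring.
  apply: in_sqB => //; apply: in_sqB; last by apply: in_sq_mull; exact: mXsq.
  by apply: mXsq => //; rewrite -(prednK M0) exprS; apply: in_maxMr.
have m1 := @in_max_1 p Phi ip.
have [pN|npN] := boolP (p %| N)%N; last first.
  (* Case p prime to N M: the derivative puts L in m, and then [trinomial_mod_sq] puts delta (1 - N
     L) in m^2. *)
  have mL : in_max p Phi L.
    apply: (@in_max_natM _ _ pp ip (N * M)); first by rewrite Euclid_dvdM // negb_or npN.
    rewrite natrM -trinomial_deriv; apply: in_maxB; last exact: in_maxMl.
    by apply: in_maxMl; exact: in_sq_deriv.
  have [Q eQ] := trinomial_mod_sq oN.
  apply: m1; rewrite (_ : 1 = (1 - N%:R * L) + N%:R * L); last by rewrite subrK.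
  apply: in_maxD; last exact: in_maxMl.
  apply: (@in_sq_natM _ _ pp ip (E + 1)); first exact: (not_sq _ _ sE).
  rewrite (_ : _ * _ = E%:R * f - Q * (L * L)); last by rewrite eQ; ring.
  by apply: in_sqB; apply: in_sq_mull => //; exact: mXsq.
(* Case p | N: write N = k p. Mod p, M = -1 and f = (x^k + 1)^p, so Y = x^k is -1 modulo m, and x is
   not in m. *)
have [k ek] := dvdnP pN.
have npk : ~~ (p %| k)%N.
  apply/negP => pk; have /negP := not_sq N _ sNM (dvdn_mulr _ (dvdnn _)); apply.
  by rewrite ek expnS expn1 dvdn_mul.
have mN : in_max p Phi N%:R by apply: in_max_dvd.
have mpp : in_max p Phi p%:R by apply: in_max_dvd.
pose Y : {poly int} := 'X^k.
have eY : 'X^N = Y ^+ p by rewrite -exprM -ek.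
have mXN : in_max p Phi ('X^N - M%:R).
  rewrite (_ : _ - _ = f + N%:R * (M%:R ^+ b * 'X)); last by rewrite fE; ring.
  by apply: in_maxD => //; apply: in_maxMr.
have mY : in_max p Phi (Y + 1).
  apply: (@in_max_exp _ _ ip _ p).
  have -> : in_max p Phi ((Y + 1) ^+ p) = in_max p Phi ('X^N - M%:R).
    rewrite /in_max rmorphXn rmorphD rmorph1 /= exprDn_pchar; last first.
      by rewrite pnatE // pchar_poly pchar_Fp.
    rewrite expr1n -rmorphXn /= -eY redpB; congr (_ %| _ + _).
    have := redp_p pp; have : redp p N%:R = 0 by rewrite ek natrM rmorphM /= redp_p // mulr0.
    by rewrite eN rmorphD rmorph1 /= => /eqP; rewrite addrC addr_eq0 => /eqP.
  exact: mXN.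
have nX : in_max p Phi 'X -> False.
  move=> mX; apply: m1; rewrite (_ : 1 = (Y + 1) - Y); last by ring.
  apply: in_maxB => //; rewrite /Y; have k0 : (0 < k)%N by case: (k) ek.
  by rewrite -(prednK k0) exprS; apply: in_maxMr.
have [p2|p_odd] := even_prime pp.
  (* For p = 2, x^N - 1 is in m^2, and subtracting f leaves 2 (k M^b x + k - 1). As k is odd, k - 1
     is in m, hence so is x. *)
  have e2 : 'X^N - 1 = (Y + 1) * (Y + 1) - 2%:R * (Y + 1) by rewrite eY p2; ring.
  have eM : M%:R = 2%:R * k.-1%:R + 1 :> {poly int}.
    rewrite -natrM natr1; congr (_%:R); by move: ek npk; rewrite /N p2; clear; lia.
  have eNk : N%:R = 2%:R * k%:R :> {poly int} by rewrite ek p2 natrM mulrC.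
  have : in_max p Phi (k%:R * (M%:R ^+ b * 'X) + k.-1%:R).
    apply: (@in_sq_natM _ _ pp ip 2); first by rewrite p2.
    rewrite (_ : _ * _ = 'X^N - 1 - f); last first.
      by rewrite fE eNk; move: (_ ^+ b) => A; rewrite eM; ring.
    apply: in_sqB => //; rewrite e2; apply: in_sqB; apply: mXsq => //.
    by rewrite -p2.
  have : in_max p Phi k.-1%:R.
    by apply: in_max_dvd => //; move: npk; rewrite p2; clear; lia.
  move=> mk1 /in_maxB /(_ mk1); rewrite addrK => /(in_max_natM pp ip npk).
  rewrite -natrX => /(in_max_natM pp ip) mX; apply: nX; apply: mX.
  by rewrite Euclid_dvdX // (negPf npM).
(* For p odd, x^N + 1 is in m^2, and x^N + 1 - f = N L. *)
have mL : in_max p Phi L.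
  have [T eT] := expr_sub1_mod_sq (Y + 1) p.
  have {}eT : 'X^N + 1 = (Y + 1) * (p%:R + (Y + 1) * T).
    rewrite eY -[Y in Y ^+ p](addrK 1) eT -signr_odd p_odd expr1; ring.
  apply: (@in_sq_natM _ _ pp ip N).
    by apply: (not_sq _ _ sNM); exact: dvdn_mulr.
  rewrite (_ : _ * _ = 'X^N + 1 - f); last by rewrite fE eN /L; ring.
  apply: in_sqB => //; rewrite eT; apply: mXsq => //.
  by apply: in_maxD => //; apply: in_maxMr.
have mMb n : in_max p Phi (M%:R ^+ n - (-1) ^+ n).
  rewrite subrXX; apply: in_maxMr; rewrite opprK -eN //.
have mX1 : in_max p Phi ('X - (-1) ^+ b.+1).
  rewrite (_ : _ - _ = (-1) ^+ b * (L - (M%:R ^+ b - (-1) ^+ b) * 'X)).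
    by apply: in_maxMl; apply: in_maxB => //; apply: in_maxMr.
  have e1 : (-1) ^+ b * (-1) ^+ b = 1 :> {poly int} by rewrite -exprMn mulrNN mulr1 expr1n.
  rewrite /L; transitivity ((-1) ^+ b + ((-1) ^+ b * (-1) ^+ b) * 'X : {poly int}); last by ring.
  by rewrite e1 exprS; ring.
(* Modulo m, L = 0 and M = -1 make x a sign. As k is even, x^k is 1, whereas Y was -1, so 2 is in
   m. *)
have ok : ~~ odd k by move: oN; rewrite ek oddM p_odd andbT.
have : in_max p Phi (Y - 1).
  have e : ((-1) ^+ b.+1) ^+ k = 1 :> {poly int}.
    by rewrite -exprM mulnC exprM -[X in X ^+ b.+1]signr_odd (negPf ok) expr0 expr1n.
  by rewrite -[X in _ - X]e subrXX; apply: in_maxMr.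
move=> mY1; have : in_max p Phi 2%:R.
  by rewrite (_ : 2%:R = (Y + 1) - (Y - 1)); [exact: in_maxB | ring].
move/(in_max_nat pp ip); rewrite dvdn_prime2 // => /eqP p2.
by rewrite p2 in p_odd.
Qed.

(** Here Phi = x, because f is x^N mod p. *)
Lemma not_monogenic_M p : (1 < M)%N -> (0 < b)%N -> prime p -> (p ^ 2 %| M)%N -> ~ monogenic f.
Proof.
move=> M1 b0 pp /dvdnP [k ek]; have M0 := ltnW M1.
have [mf sf] := trinomial_monic M0.
have eM : M%:R = p%:R ^+ 2 * k%:R :> {poly int} by rewrite ek natrM natrX mulrC.
have eb : M%:R ^+ b = M%:R * M%:R ^+ b.-1 :> {poly int} by rewrite -exprS prednK.
have ef : f = 'X^(M.-1) * 'X ^+ 2 +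
   p%:R * (- (N%:R * (p%:R * k%:R) * M%:R ^+ b.-1)) * 'X + p%:R ^+ 2 * (- k%:R).
  rewrite trinomialE eb -exprD addn2 prednK //; move: (_ ^+ b.-1) => A.
  by rewrite eM; ring.
apply: (not_monogenic_of_sq pp ef).
- by rewrite -exprSr monicXn.
- by rewrite -exprSr size_polyXn sf prednK.
Qed.

(** Here Phi = x^(N/p) + 1. For odd p, x^N + 1 = (Phi - 1)^p + 1 = p Phi + T Phi^2, and f = x^N + 1
    - N L with p^2 dividing N. *)
Lemma not_monogenic_N p : (0 < M)%N -> ~~ odd N ->
  prime p -> odd p -> (p ^ 2 %| N)%N -> ~ monogenic f.
Proof.
move=> M0 oN pp p_odd /dvdnP [k ek]; have p1 := prime_gt1 pp.
have [mf sf] := trinomial_monic M0.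
pose Phi : {poly int} := 'X^(k * p) + 1.
have k0 : (0 < k)%N by case: (k) ek.
have kp0 : (0 < k * p)%N by rewrite muln_gt0 k0 prime_gt0.
have [T eT] := expr_sub1_mod_sq Phi p.
have {}eT : 'X^N + 1 = p%:R * Phi + Phi ^+ 2 * T.
  have -> : 'X^N = (Phi - 1) ^+ p by rewrite /Phi addrK -exprM ek; congr (_ ^+ _); ring.
  rewrite eT -signr_odd p_odd expr1; ring.
have eN : N%:R = p%:R ^+ 2 * k%:R :> {poly int} by rewrite ek natrM natrX mulrC.
have ef : f = T * Phi ^+ 2 + p%:R * 1 * Phi + p%:R ^+ 2 * (- (k%:R * L)).
  have -> : p%:R ^+ 2 * (- (k%:R * L)) = - (N%:R * L) by rewrite eN; ring.
  have -> : T * Phi ^+ 2 + p%:R * 1 * Phi = 'X^N + 1 by rewrite eT; ring.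
  rewrite trinomialE /L; rewrite -[N]addn1 natrD; ring.
have sPhi : size Phi = (k * p).+1 by rewrite /Phi size_XnaddC.
have mPhi : Phi \is monic by rewrite /Phi monicXnaddC.
have [|||mT sT] := @monic_factor_of_sq f T (p%:R * 1 * Phi + p%:R ^+ 2 * (- (k%:R * L))) Phi mf mPhi.
- by rewrite sPhi.
- by rewrite addrA.
- have -> : p%:R * 1 * Phi + p%:R ^+ 2 * (- (k%:R * L)) =
     p%:R *: Phi - ((N%:R * M%:R ^+ b) *: 'X + N%:R%:P).
    by rewrite -!mul_polyC polyCM polyC_exp !polyC_natr eN /L; ring.
  rewrite sf ltnS (leq_trans (size_polyD _ _)) // geq_max (leq_trans (size_scale_leq _ _)) /=.
    rewrite size_polyN (leq_trans (size_polyD _ _)) // geq_max (leq_trans (size_scale_leq _ _)).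
      by rewrite (leq_trans (size_polyC_leq1 _)) // /N; lia.
    by rewrite size_polyX /N; lia.
  by rewrite sPhi ek; nia.
exact: (not_monogenic_of_sq pp ef).
Qed.

Lemma not_monogenic_delta p : (1 < M)%N -> ~~ odd N ->
  prime p -> (p ^ 2 %| E + 1)%N -> ~ monogenic f.
Proof.
move=> M1 oN pp pd; have p1 := prime_gt1 pp; have M0 := ltnW M1.
have [mf sf] := trinomial_monic M0.
have q1 : (1 < p ^ 2)%N by rewrite -(exp1n 2) ltn_exp2r.
have [u [a [r [ef sr]]]] := trinomial_mod_sq_shift q1 oN M0 pd.
set Phi := 'X + u%:P in ef.
have mPhi : Phi \is monic by rewrite monicXaddC.
have [||mT sT] := monic_factor_of_sq mf mPhi _ ef.
- by rewrite size_XaddC.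
- rewrite -polyC_natr mul_polyC (leq_ltn_trans (size_scale_leq _ _)) // sf.
  by rewrite (leq_trans sr) // /N; lia.
apply: (@not_monogenic_of_sq p f a 0 r Phi pp) => //.
by rewrite ef natrX; ring.
Qed.

Lemma trinomial_monogenicP : (4 < M)%N -> (0 < b)%N -> (N = 2 %[mod 4])%N ->
  irreducibleQ f ->
  monogenic f <-> squarefree (N * M) /\ squarefree (E + 1).
Proof.
move=> M4 b0 N4 irf; have M1 : (1 < M)%N by lia.
have oN : ~~ odd N by rewrite /N in N4 *; lia.
have [mf sf] := trinomial_monic (ltnW M1).
split=> [mon|[sNM sE]]; last first.
  apply: monogenic_of_maximal => //; first by rewrite sf /N; lia.
  by move=> p Phi pp ip; apply: trinomial_in_max.
have sqf n : (0 < n)%N -> (forall p, prime p -> ~~ (p ^ 2 %| n)%N) -> squarefree n.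
  move=> n0 H d dn; apply/eqP/negPn/negP => d1.
  have d0 : (0 < d)%N by case: d dn d1 => //; rewrite expnS mul0n dvd0n => /eqP e;
    rewrite e in n0.
  have dd : (1 < d)%N by lia.
  have /negP := H _ (pdiv_prime dd); apply; apply: dvdn_trans dn.
  by rewrite dvdn_exp2r ?pdiv_dvd.
split; last first.
  apply: sqf => [|p pp]; first by rewrite addn1.
  by apply/negP => pd; exact: (not_monogenic_delta M1 oN pp pd mon).
apply: sqf => [|p pp]; first by rewrite muln_gt0 /= ltnW.
apply/negP => pd.
  have cNM : coprime N M by rewrite coprimeSn.
  have [pM|npM] := boolP (p %| M)%N.
    apply: (not_monogenic_M M1 b0 pp _ mon).
    rewrite -(@Gauss_dvdr _ N) // coprimeXl // prime_coprime //.
    apply/negP => pN; have : (p %| gcdn N M)%N by rewrite dvdn_gcd pN.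
    by rewrite (eqP cNM) dvdn1 => /eqP p1; rewrite p1 in pp.
  have pN : (p ^ 2 %| N)%N by rewrite -(@Gauss_dvdl _ _ M) // coprimeXl // prime_coprime.
  apply: (not_monogenic_N (ltnW M1) oN pp _ pN mon).
  (* For p = 2, the congruence N = 2 mod 4 excludes 4 | N. *)
  by case: (even_prime pp) => // p2; rewrite p2 /N in pN N4; lia.
Qed.

End Trinomial.

(** * Distinct fields *)

(* A common factor of f and f' mod p divides N M L, hence L, hence delta. *)
Lemma trinomial_separable (M b p : nat) : prime p -> ~~ odd M.+1 ->
  ~~ (p %| M.+1 * M)%N -> ~~ (p %| M ^ (b * M.+1) + 1)%N ->
  coprimep (redp p (trinomial M.+1 b)) (redp p (trinomial M.+1 b)^`()).
Proof.
move=> pp oN npNM npE; set f := trinomial M.+1 b.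
apply/negPn/negP => nc.
have f0 : redp p f != 0.
  have M0 : (0 < M)%N by case: (M) npNM => //; rewrite muln0 dvdn0.
  by have [mf _] := trinomial_monic b M0; apply: monic_neq0; exact: redp_monic.
have sg : (1 < size (gcdp (redp p f) (redp p f^`())))%N.
  move: nc; rewrite /coprimep;
    have : gcdp (redp p f) (redp p f^`()) != 0 by rewrite gcdp_eq0 negb_and f0.
  by rewrite -size_poly_gt0; case: (size _) => [|[]].
have [phi ip dphi] := irred_divisor sg.
have [Phi ePhi] := redp_surj phi.
rewrite -ePhi in ip dphi.
have mf : in_max p Phi f by apply: dvdp_trans dphi (dvdp_gcdl _ _).
have mf' : in_max p Phi f^`() by apply: dvdp_trans dphi (dvdp_gcdr _ _).
have mL : in_max p Phi (M%:R ^+ b * 'X + 1).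
  apply: (in_max_natM pp ip npNM).
  by rewrite natrM -trinomial_deriv; apply: in_maxB; apply: in_maxMl.
have [Q eQ] := trinomial_mod_sq b oN.
apply: (@in_max_1 p Phi ip); apply: (in_max_natM pp ip npE).
rewrite mulr1; move: eQ; set L := _ + 1 : {poly int} => eQ.
rewrite (_ : (_ + 1)%:R = (M ^ (b * M.+1))%:R * f + (M.+1%:R * (M ^ (b * M.+1) + 1)%:R - L * Q) * L).
  by apply: in_maxD; apply: in_maxMl.
by rewrite eQ; ring.
Qed.

(** Take a prime factor of e / gcd(e, d), which exceeds 1 because the gcd is at most d. If it
    divided d it would divide the gcd too, and its square would divide e. *)
Lemma exists_new_prime (d e : nat) : (0 < d)%N -> (d < e)%N -> squarefree e ->
  exists2 p, prime p & (p %| e)%N && ~~ (p %| d)%N.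
Proof.
move=> d0 de sqe.
have e0 : (0 < e)%N := leq_ltn_trans (leq0n d) de.
have [k ek] := dvdnP (dvdn_gcdl e d).
have g0 : (0 < gcdn e d)%N by rewrite gcdn_gt0 e0.
have gd : (gcdn e d <= d)%N by rewrite dvdn_leq ?dvdn_gcdr.
have k1 : (1 < k)%N by move: ek gd de; nia.
exists (pdiv k); first exact: pdiv_prime.
have pe : (pdiv k %| e)%N by rewrite ek dvdn_mulr // pdiv_dvd.
rewrite pe /=; apply/negP => pd.
have := sqe (pdiv k); have := pdiv_prime k1 => pp H; have := prime_gt1 pp.
by rewrite H // ek expnS expn1 dvdn_mul ?pdiv_dvd // dvdn_gcd pe pd.
Qed.

(** With f_b' = a Phi^2 + p r, the number (a Phi)(z') has its square in p O, where O is the common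
    ring of integers. Written as G(z), it has f_b dividing G^2 mod p, hence G by separability, so it
    lies in p O; then p divides the monic a Phi. *)
Lemma trinomial_distinct_fields (M b b' : nat) :
  (4 < M)%N -> M.+1 = 2 %[mod 4] -> (0 < b)%N -> (b < b')%N ->
  monogenic (trinomial M.+1 b) -> monogenic (trinomial M.+1 b') ->
  ~ same_extension (trinomial M.+1 b) (trinomial M.+1 b').
Proof.
move=> M4 N4 b0 bb mon mon' [z [z' [fz fz' eK]]].
have M0 : (0 < M)%N by apply: ltn_trans M4.
have oN : ~~ odd M.+1 by lia.
have oM : odd M by lia.
set N := M.+1 in mon mon' fz fz' oN N4 *.
have [_ _ irf _] := mon; have [_ _ irf' _] := mon'.
have [mf sf] := trinomial_monic b M0; have [mf' sf'] := trinomial_monic b' M0.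
have [_ sqE'] := (trinomial_monogenicP M4 (ltn_trans b0 bb) N4 irf').1 mon'.
have lt : (M ^ (b * N) + 1 < M ^ (b' * N) + 1)%N.
  by rewrite ltn_add2r ltn_exp2l ?ltn_pmul2r // (ltn_trans _ M4).
have [p pp /andP[pE' npE]] := exists_new_prime (ltn_addl _ (ltn0Sn 0)) lt sqE'.
have p1 := prime_gt1 pp.
have npM : ~~ (p %| M)%N.
  apply/negP => pM; have : (p %| 1)%N.
    move: pE'; rewrite dvdn_addr //; apply: dvdn_exp => //.
    by rewrite muln_gt0 (ltn_trans b0 bb).
  by rewrite dvdn1 => /eqP pe; rewrite pe in p1.
have npN : ~~ (p %| N)%N.
  apply/negP => pN.
  (* If p | N then M = -1 mod p and, N being even, delta_b' = 2 mod p. So p = 2, but 2 divides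
     delta_b since M is odd. *)
  have e1 : M ^ (b' * N) = 1 %[mod p].
    have [k ek] : exists k, N = (2 * k)%N by exists N./2; rewrite mul2n; lia.
    rewrite ek mulnCA expnM -modnXm.
    have -> : M ^ 2 = 1 %[mod p].
      apply/eqP; rewrite eqn_mod_dvd ?expn_gt0 ?M0 //.
      by rewrite -[X in (_ - X)%N](exp1n 2) subn_sqr addn1 dvdn_mull.
    by rewrite modnXm exp1n.
  have : (p %| 2)%N.
    by move: pE'; rewrite /dvdn -modnDml e1 modnDml.
  rewrite dvdn_prime2 // => /eqP p2; case/negP: npE.
  by rewrite p2 dvdn2 oddD oddX oM orbT.
have npNM : ~~ (p %| N * M)%N by rewrite Euclid_dvdM // negb_or npN.
have cop := trinomial_separable pp oN npNM npE.
have [u [a [r [ef sr]]]] := trinomial_mod_sq_shift p1 oN M0 pE'.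
set Phi := 'X + u%:P in ef.
have mPhi : Phi \is monic by rewrite monicXaddC.
have [||mT sT] := monic_factor_of_sq mf' mPhi _ ef.
- by rewrite size_XaddC.
- rewrite -polyC_natr mul_polyC (leq_ltn_trans (size_scale_leq _ _)) // sf'.
  by rewrite (leq_trans sr) // /N; lia.
have zA := croot_Aint mf fz; have zA' := croot_Aint mf' fz'.
have toz P : exists H, evz z' P = evz z H.
  have [|H [eH _]] := @monogenic_integers _ z (evz z' P) mon fz; last by exists H.
  by split; [rewrite eK; exact: adjoinQ_evz | exact: evz_Aint].
have [G eG] := toz (a * Phi); have [H eH] := toz (a * r).
have G2 : evz z (G ^+ 2 + p%:R * H) = 0.
  rewrite rmorphD rmorphXn /= rmorphM /= -eG -eH rmorph_nat.
  rewrite -(rmorph_nat (evz z') p) -rmorphXn -rmorphM -rmorphD /=.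
  rewrite (_ : _ + _ = a * trinomial N b'); last by rewrite ef; ring.
  by rewrite rmorphM /= [evz z' (trinomial _ _)]evzE (rootP fz') mulr0.
have [Q eQ] := evz_eq0 mf irf fz G2.
have fG : redp p (trinomial N b) %| redp p G.
  apply: coprimep_dvd_sqr; first by apply: monic_neq0; exact: redp_monic.
    by rewrite /redp -deriv_map in cop *.
  rewrite -rmorphXn /= -[G ^+ 2](addrK (p%:R * H)) eQ [X in _ %| X]redpB !rmorphM /= redp_p //.
  by rewrite mul0r subr0 dvdp_mull.
have [q [H' eG']] := in_maxP pp fG.
have [|H'' [eH'' sH'']] := @monogenic_integers _ z' (evz z H') mon' fz'.
  by split; [rewrite -eK; exact: adjoinQ_evz | exact: evz_Aint].
have : a * Phi - p%:R * H'' = 0.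
  apply: (evz_small_eq0 irf' fz').
    rewrite (leq_ltn_trans (size_polyD _ _)) // size_polyN gtn_max sT /=.
    by rewrite -polyC_natr mul_polyC (leq_ltn_trans (size_scale_leq _ _)).
  rewrite rmorphB /= eG (@evzB_dvd _ z G (p%:R * H') q fz); last by rewrite eG' addrC.
  by rewrite !rmorphM /= !rmorph_nat -eH'' subrr.
move/eqP; rewrite subr_eq0 => /eqP e.
by rewrite e in mT; rewrite (monic_natM_eq1 mT) in p1.
Qed.

(** * The class number of Q(sqrt(M^(2n) + 1)) *)

Section ClassNumber.
Local Open Scope classical_set_scope.
Local Open Scope card_scope.

(** Carried over to ['I_h] by the bijection, sigma becomes a permutation all of whose orbits have m
    elements. *)
Lemma free_cyclic_action_dvd (U : Type) (C : set U) (sigma : U -> U) (h m : nat) :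
  C #= `I_h -> (0 < m)%N ->
  (forall x, C x -> C (sigma x)) ->
  (forall x, C x -> iter m sigma x = x) ->
  (forall x k, C x -> (0 < k < m)%N -> iter k sigma x <> x) ->
  (m %| h)%N.
Proof.
move=> /card_set_bijP [f [fC fI fS]] m0 sC sm sfree.
have /choice [g gP] (i : 'I_h) : exists x, C x /\ f x = i.
  by have [x Cx fx] := fS _ (ltn_ord i); exists x.
have fCo x : C x -> (f x < h)%N by move/fC.
pose s (i : 'I_h) : 'I_h := Ordinal (fCo _ (sC _ (gP i).1)).
have gs i : g (s i) = sigma (g i).
  by apply: fI; rewrite ?inE; [exact: (gP _).1 | apply: (sC); exact: (gP _).1 | rewrite (gP _).2].
have gsk k i : g (iter k s i) = iter k sigma (g i).
  by elim: k => //= k IH; rewrite gs IH.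
have gI i j : g i = g j -> i = j.
  by move=> e; apply: val_inj; rewrite /= -(gP i).2 e (gP j).2.
have sK i : iter m s i = i by apply: gI; rewrite gsk sm //; exact: (gP i).1.
have sI : injective s.
  move=> i j e; rewrite -(sK i) -(sK j) -(prednK m0) !iterSr.
  by rewrite e.
have om i : fingraph.order s i = m.
  apply/eqP; rewrite eqn_leq; apply/andP; split.
    rewrite leqNgt; apply/negP => lt; have := findex_iter lt; rewrite sK.
    have := @findex_iter _ s i 0 (order_gt0 _ _) => /= -> e; by rewrite -e in m0.
  rewrite leqNgt; apply/negP => lt.
  apply: (sfree (g i) (fingraph.order s i) (gP i).1); first by rewrite order_gt0.
  by rewrite -gsk iter_order.
have := @fcard_order_set _ s sI m predT.
rewrite card_ord => <-; first exact: dvdn_mull.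
  by apply/fintype.subsetP => i _; rewrite inE /= om.
by [].
Qed.

Lemma int_ideal_gen (P : int -> Prop) n :
  (forall x y k, P x -> P y -> P (x + k * y)) -> P n -> n != 0 ->
  exists g : int, [/\ 0 < g, P g & forall x, P x -> (g %| x)%Z].
Proof.
move=> PD Pn n0.
have P0 : P 0 by have := PD n n (-1) Pn Pn; rewrite mulN1r subrr.
have ex : exists k, (0 < k)%N && `[< P k%:Z >].
  exists `|n|%N; rewrite absz_gt0 n0; apply/asboolP.
  by rewrite abszEsg -[_ * _]add0r; exact: PD.
case: (ex_minnP ex) => k /andP[k0 /asboolP Pk] kmin.
exists k%:Z; split=> // x Px.
have Pr : P (x %% k)%Z.
  have := PD x k%:Z (- (x %/ k)%Z) Px Pk.
  by rewrite {1}(divz_eq x k) mulNr addrAC subrr add0r.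
have k0' : k%:Z != 0 by rewrite -lt0n.
have r0 := modz_ge0 x k0'; have rk := ltz_pmod x (k0 : 0 < k%:Z).
apply/dvdz_mod0P; apply/eqP/negPn/negP => rn0.
have := kmin `|(x %% k)%Z|%N; rewrite absz_gt0 rn0 /= gez0_abs // leqNgt => H.
have /H : `[< P (x %% k)%Z >] by apply/asboolP.
by rewrite -ltz_nat gez0_abs // rk.
Qed.

(* Descent on y: multiply x + y sqrt(T^2 + 1) by the unit sqrt(T^2 + 1) - T. *)
Lemma small_norm_square (T x y : int) : 1 <= T ->
  `|x ^+ 2 - (T ^+ 2 + 1) * y ^+ 2| <= T ->
  exists d : int, [/\ (d %| x)%Z, (d %| y)%Z &
    `|x ^+ 2 - (T ^+ 2 + 1) * y ^+ 2| = d ^+ 2].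
Proof.
move=> T1.
wlog [x0 y0] : x y / 0 <= x /\ 0 <= y.
  move=> H; rewrite -(real_normK (num_real x)) -(real_normK (num_real y)) => h.
  have [|d [dx dy e]] := H `|x| `|y| _ h; first by rewrite !normr_ge0.
  by exists d; split=> //; rewrite dvdzE -abszE ?absz_nat in dx dy *.
have [n] := ubnP `|y|%N; elim: n x y x0 y0 => // n IH x y x0 y0 yn h.
have [y1|y1] := leP y 0.
  have -> : y = 0 by lia.
  by exists x; rewrite dvdzz dvdz0 expr0n mulr0 subr0 ger0_norm ?sqr_ge0.
pose x' := (T ^+ 2 + 1) * y - T * x; pose y' := x - T * y.
have eN : x' ^+ 2 - (T ^+ 2 + 1) * y' ^+ 2 = - (x ^+ 2 - (T ^+ 2 + 1) * y ^+ 2).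
  by rewrite /x' /y'; ring.
(* For y = 1 the bound on the norm forces x = T. For y >= 2, (x - T y)(x + T y) = norm + y^2 is at
   most T + y^2, too small if [|x - T y|] were at least y. *)
have y'y : `|y'| < y.
  have /andP[h1 h2] : - T <= x ^+ 2 - (T ^+ 2 + 1) * y ^+ 2 <= T by rewrite -ler_norml.
  have TT : T <= T ^+ 2 by rewrite expr2 ler_peMl //; lia.
  have yy1 : y <= y ^+ 2 by rewrite expr2 ler_peMl //; lia.
  have TY : T ^+ 2 + 1 <= (T ^+ 2 + 1) * y ^+ 2 by rewrite ler_peMr //; lia.
  have x1 : 1 <= x.
    rewrite -gtz0_ge1 lt_neqAle x0 andbT; apply/negP => /eqP x0'.
    by rewrite -x0' expr0n /= in h1; lia.
  have [y2|y2] := lerP y 1.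
    have ye : y = 1 by lia.
    rewrite /y' ye mulr1 in h1 h2 *.
    have [xT|xT|xT] := ltrgtP x T; last by [].
      have : x * x <= (T - 1) * (T - 1) by apply: ler_pM => //; lia.
      by rewrite !expr2 in h1 h2; lia.
    have : (T + 1) * (T + 1) <= x * x by apply: ler_pM => //; lia.
    by rewrite !expr2 in h1 h2; lia.
  have fac : (x - T * y) * (x + T * y) = (x ^+ 2 - (T ^+ 2 + 1) * y ^+ 2) + y ^+ 2 by ring.
  rewrite ltNge; apply/negP => yy.
  have Ty : 0 <= T * y by apply: mulr_ge0 => //; lia.
  have a1 : `|y'| * (x + T * y) <= T + y ^+ 2.
    have p : 0 <= x + T * y by lia.
    by rewrite -{1}(ger0_norm p) -normrM /y' fac ler_norml; lia.
  have a2 : y * (1 + T * y) <= `|y'| * (x + T * y).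
    by apply: ler_pM => //; lia.
  have a3 : 0 <= (T - 1) * (y ^+ 2 - 1) by apply: mulr_ge0; lia.
  have : y + T * y ^+ 2 <= T + y ^+ 2.
    by rewrite (_ : y + _ = y * (1 + T * y)); [exact: le_trans a2 a1 | ring].
  by move: a3; rewrite mulrBl mulrBr mulr1 mul1r; lia.
have [||d [dx dy ed]] := IH `|x'| `|y'| (normr_ge0 _) (normr_ge0 _).
- by lia.
- by rewrite !real_normK ?num_real // eN normrN.
rewrite !real_normK ?num_real // eN normrN in ed.
have {}dx : (d %| x')%Z by rewrite dvdzE -abszE in dx *.
have {}dy : (d %| y')%Z by rewrite dvdzE -abszE in dy *.
exists d; split=> //.
  rewrite (_ : x = T * x' + (T ^+ 2 + 1) * y'); last by rewrite /x' /y'; ring.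
  by rewrite rpredD // dvdz_mull.
rewrite (_ : y = x' + T * y'); last by rewrite /x' /y'; ring.
by rewrite rpredD // dvdz_mull.
Qed.

(** * The ring of integers of Q(sqrt D) *)

Section Quadratic.
Variables (D t : nat).
Hypotheses (t0 : (0 < t)%N) (Dt : D = (t ^ 2 + 1)%N) (Deven : ~~ odd D) (Dsq : squarefree D).
Let s : algC := sqrtC D%:R.
Let O := ring_of_integers (adjoinQ s).
Let F : {poly int} := 'X^2 - D%:R.

Definition qint (x y : int) : algC := x%:~R + y%:~R * s.

Lemma sqr_s : s ^+ 2 = D%:R. Proof. exact: sqrtCK. Qed.

Lemma sizeF : size F = 3.
Proof. by rewrite /F -polyC_natr size_XnsubC. Qed.

Lemma monicF : F \is monic.
Proof. by rewrite /F -polyC_natr monicXnsubC. Qed.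

Lemma rootF : croot F s.
Proof. by apply/rootP; rewrite -evzE rmorphB rmorphXn /= evzX rmorph_nat sqr_s subrr. Qed.

Lemma irrF : irreducibleQ F.
Proof.
apply: cubic_irreducible; first by rewrite size_map_intr sizeF.
move=> x; apply/negP => /rootP Fx.
have x2 : x ^+ 2 = D%:R.
  move/eqP: Fx; rewrite rmorphB /= rmorph_nat map_polyXn hornerD hornerN hornerXn.
  by rewrite -polyC_natr hornerC subr_eq0 => /eqP.
have xA : (ratr x : algC) \in Aint.
  apply: (@root_monic_Aint (map_poly intr F)).
  - apply/rootP; rewrite -evzE rmorphB rmorphXn /= evzX rmorph_nat.
    by rewrite -rmorphXn x2 /= rmorph_nat subrr.
  - exact: monic_map monicF.
  - by apply/polyOverP => i; rewrite coef_map /= intr_int.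
have /intrP [k ek] : (ratr x : algC) \is a Num.int by apply: Cint_rat_Aint => //; apply/CratP;
  exists x.
have : (k ^+ 2 = D%:Z).
  have : (k ^+ 2)%:~R = D%:R :> algC by rewrite rmorphXn /= -ek -rmorphXn x2 /= rmorph_nat.
  by rewrite [D%:R](_ : _ = D%:Z%:~R) // => /eqP; rewrite eqr_int => /eqP.
rewrite Dt => e; have : (`|k| ^ 2 = t ^ 2 + 1)%N.
  by apply/eqP; rewrite -eqz_nat -abszX e.
(* t^2 + 1 lies strictly between t^2 and (t + 1)^2. *)
by move=> h; have [le|gt] := leqP `|k| t; nia.
Qed.

(** Dedekind's criterion applied to F = x^2 - D. If F is in m^2 then x is in m, by F' = 2 x for odd
    p and by D even for p = 2; so D = x^2 - F is in m^2, against D squarefree. *)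
Lemma O_qint x : O x <-> exists a b, x = qint a b.
Proof.
have mF := monicF; have fz := rootF; have iF := irrF.
split=> [Ox|[a [b ->]]]; last first.
  have -> : qint a b = evz s (a%:P + b%:P * 'X).
    by rewrite rmorphD rmorphM /= !evzC evzX.
  split; first exact: adjoinQ_evz.
  by apply: evz_Aint; exact: (croot_Aint mF).
have [|P eP] := integers_eq_evz mF iF fz _ Ox.
  move=> p Phi pp ip mFp sqF.
  have p1 := prime_gt1 pp.
  have nDp : ~~ (p ^ 2 %| D)%N by apply/negP => /Dsq; lia.
  have mX : in_max p Phi 'X.
    have [p2|npo] := even_prime pp.
      apply: (@in_max_exp _ _ ip _ 2); rewrite -[_ ^+ _](subrK D%:R).
      by apply: in_maxD => //; apply: in_max_dvd => //; rewrite p2 dvdn2.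
    apply: (@in_max_natM p Phi pp ip 2).
      by rewrite dvdn_prime2 //; apply/negP => /eqP p2; rewrite p2 in npo.
    have <- : F^`() = 2%:R * 'X.
      by rewrite /F derivB derivXn expr1 -[D%:R]polyC_natr derivC subr0 -mulr_natl.
    exact: in_sq_deriv pp _ _ sqF.
  apply: (@in_max_1 p Phi ip); apply: (in_sq_natM pp ip nDp).
  rewrite (_ : D%:R * 1 = 'X * 'X - F); last by rewrite /F; ring.
  by apply: in_sqB => //; exact: in_sqM.
have [Q [R [eR sR]]] := rmodp_monicE P mF.
exists R`_0, R`_1; rewrite eP (evzB_dvd fz eR) evzE (@horner_coef_wide _ 2); last first.
  by rewrite size_map_intr; move: sR; rewrite sizeF.
by rewrite big_ord_recl big_ord1 /= !coef_map /= expr0 mulr1 expr1.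
Qed.

Lemma qint_inj a b c d : qint a b = qint c d -> a = c /\ b = d.
Proof.
move=> e.
have : (a - c)%:P + (b - d)%:P * 'X = 0 :> {poly int}.
  apply: (evz_small_eq0 irrF rootF).
    rewrite sizeF (leq_ltn_trans (size_polyD _ _)) // gtn_max mul_polyC.
    rewrite (leq_ltn_trans (size_polyC_leq1 _)) //.
    by rewrite (leq_ltn_trans (size_scale_leq _ _)) // size_polyX.
  rewrite rmorphD rmorphM /= !evzC evzX !rmorphB /=.
  by move/eqP: e; rewrite -subr_eq0 /qint => /eqP <-; ring.
move/polyP => P0; have := P0 0%N; have := P0 1%N.
rewrite !coefD !coefMX !coefC /= add0r addr0 => /eqP + /eqP.
by rewrite !subr_eq0 => /eqP -> /eqP ->.
Qed.

Lemma qintD a b c d : qint a b + qint c d = qint (a + c) (b + d).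
Proof. by rewrite /qint !rmorphD /=; ring. Qed.

Lemma qintM a b c d : qint a b * qint c d = qint (a * c + D%:Z * b * d) (a * d + b * c).
Proof.
rewrite /qint !rmorphD !rmorphM /=.
transitivity (a%:~R * c%:~R + s ^+ 2 * b%:~R * d%:~R + (a%:~R * d%:~R + b%:~R * c%:~R) * s);
  first by ring.
by rewrite sqr_s.
Qed.

Lemma qint_scale k a b : k%:~R * qint a b = qint (k * a) (k * b).
Proof. by rewrite /qint !rmorphM /=; ring. Qed.

Lemma qint_eq0 a b : (qint a b == 0) = (a == 0) && (b == 0).
Proof.
apply/eqP/andP => [e|[/eqP -> /eqP ->]]; last by rewrite /qint mul0r addr0.
have [|-> ->] := @qint_inj a b 0 0; last by rewrite eqxx.
by rewrite e /qint mul0r addr0.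
Qed.

Lemma qint_in_O a b : O (qint a b).
Proof. by apply/O_qint; exists a, b. Qed.

Lemma O_int (a : int) : O a%:~R.
Proof. by apply/O_qint; exists a, 0; rewrite /qint mul0r addr0. Qed.

Lemma O_D x y : O x -> O y -> O (x + y).
Proof.
move=> /O_qint [a [b ->]] /O_qint [c [d ->]]; rewrite qintD; exact: qint_in_O.
Qed.

Lemma O_M x y : O x -> O y -> O (x * y).
Proof.
move=> /O_qint [a [b ->]] /O_qint [c [d ->]]; rewrite qintM; exact: qint_in_O.
Qed.

Lemma norm_neq0 x y : (x != 0) || (y != 0) -> x ^+ 2 - D%:Z * y ^+ 2 != 0.
Proof.
move=> nz; have : qint x y * qint x (- y) != 0.
  by rewrite mulf_neq0 // qint_eq0 ?oppr_eq0 negb_and.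
rewrite qintM qint_eq0 negb_and => /orP[|/eqP e]; last by case: e; ring.
by apply: contra => /eqP e; apply/eqP; rewrite -e; ring.
Qed.

(** * Ideals as lattices, and finiteness of the class group *)

(** The lattice a Z + (b + s) Z, attached to the quadratic form (a, 2b, c) with a c = b^2 - D. *)
Definition lattice (a b : int) : set algC :=
  [set x | exists i j, x = qint (a * i + b * j) j].

(** Hermite normal form: e generates the integers of J, and h + g s has the least positive
    coefficient of s. Multiplying by s shows that g divides h and e, so h = g b and e = g a;
    multiplying h + g s by b - s shows that a divides b^2 - D. *)
Lemma ideal_lattice J : nonzero_ideal O J ->
  exists g a b c : int, [/\ g != 0, 0 < a, a * c = b ^+ 2 - D%:Z &
    forall x, J x <-> exists2 y, lattice a b y & x = g%:~R * y].
Proof.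
move=> [JO J0 JD JM [al Jal al0]].
have JB x y k : J x -> J y -> J (x + k%:~R * y).
  by move=> Jx Jy; apply: JD => //; apply: JM => //; exact: O_int.
have [u [v eal]] := (O_qint al).1 (JO _ Jal).
have nz : u ^+ 2 - D%:Z * v ^+ 2 != 0.
  by apply: norm_neq0; move: al0; rewrite eal qint_eq0 negb_and.
have JN : J (qint (u ^+ 2 - D%:Z * v ^+ 2) 0).
  have := JM (qint u (- v)) _ (qint_in_O _ _) Jal; rewrite eal qintM.
  by congr (J (qint _ _)); ring.
have [|e [e0 Je eP]] := @int_ideal_gen (fun x => J (qint x 0)) _ _ JN nz.
  move=> x y k Jx Jy; have := JB _ _ k Jx Jy.
  by rewrite qint_scale qintD mulr0 addr0.
have [||g [g0 [h Jgh] gP]] := @int_ideal_gen (fun y => exists x, J (qint x y)) (u ^+ 2 - D%:Z * v ^+ 2) _ _ nz.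
- move=> x y k [x' Jx] [y' Jy]; exists (x' + k * y'); have := JB _ _ k Jx Jy.
  by rewrite qint_scale qintD.
- exists 0; have := JM (qint 0 1) _ (qint_in_O _ _) JN; rewrite qintM.
  by congr (J (qint _ _)); ring.
have /dvdzP [b eb] : (g %| h)%Z.
  apply: gP; exists (D%:Z * g); have := JM (qint 0 1) _ (qint_in_O _ _) Jgh; rewrite qintM.
  by congr (J (qint _ _)); ring.
have /dvdzP [a ea] : (g %| e)%Z.
  apply: gP; exists 0; have := JM (qint 0 1) _ (qint_in_O _ _) Je; rewrite qintM.
  by congr (J (qint _ _)); ring.
have a0 : 0 < a by move: e0; rewrite ea pmulr_lgt0.
have g0' : g != 0 by rewrite gt_eqF.
have /dvdzP [c ec] : (e %| g * (b ^+ 2 - D%:Z))%Z.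
  apply: eP; have := JM (qint b (- 1)) _ (qint_in_O _ _) Jgh; rewrite qintM eb.
  by congr (J (qint _ _)); ring.
exists g, a, b, c; split=> //.
  by apply: (mulfI g0'); rewrite ec ea; ring.
move=> x; split.
  move=> Jx; have [x1 [y1 ex]] := (O_qint x).1 (JO _ Jx).
  have /dvdzP [j ej] : (g %| y1)%Z by apply: gP; exists x1; rewrite -ex.
  have /dvdzP [i ei] : (e %| x1 - j * h)%Z.
    apply: eP; have := JB _ _ (- j) Jx Jgh; rewrite ex qint_scale qintD.
    by congr (J (qint _ _)); rewrite ?ej; ring.
  exists (qint (a * i + b * j) j); first by exists i, j.
  rewrite ex qint_scale ej; congr (qint _ _); last by ring.
  by rewrite -[LHS](subrK (j * h)) ei ea eb; ring.
move=> [_ [i [j ->]] ->]; rewrite qint_scale.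
have := JB _ _ j (JM i%:~R _ (O_int i) Je) Jgh; rewrite !qint_scale qintD.
by congr (J (qint _ _)); rewrite ?ea ?eb; ring.
Qed.

Lemma O_1 : O 1. Proof. exact: (O_int 1). Qed.

Lemma ideal_equiv_refl J : ideal_equiv O J J.
Proof. by exists 1, 1; split=> //; split; rewrite ?oner_eq0 //; exact: O_1. Qed.

Lemma ideal_equiv_sym J K : ideal_equiv O J K -> ideal_equiv O K J.
Proof. by move=> [a [b [Ha Hb e]]]; exists b, a. Qed.

Lemma ideal_equiv_trans J K I : ideal_equiv O J K -> ideal_equiv O K I -> ideal_equiv O J I.
Proof.
move=> [a [b [[Oa a0] [Ob b0] e]]] [c [d [[Oc c0] [Od d0] e']]].
exists (c * a), (b * d); split.
- by split; [exact: O_M | rewrite mulf_neq0].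
- by split; [exact: O_M | rewrite mulf_neq0].
have mulE x y (S : set algC) : ( *%R (x * y)) @` S = ( *%R x) @` (( *%R y) @` S).
  by rewrite image_comp; congr (_ @` _); apply/funext => z /=; rewrite mulrA.
by rewrite (mulE c a) e -(mulE c b) mulrC (mulE b c) e' -(mulE b d).
Qed.

Lemma ideal_class_eq J K : ideal_equiv O J K -> ideal_class O J = ideal_class O K.
Proof.
move=> e; apply/seteqP; split=> I [nI eI]; split=> //.
  by apply: ideal_equiv_trans eI; exact: ideal_equiv_sym.
exact: ideal_equiv_trans eI.
Qed.

Lemma ideal_class_inj J K : nonzero_ideal O J ->
  ideal_class O K = ideal_class O J -> ideal_equiv O K J.
Proof.
move=> nJ e; have : ideal_class O J J by split=> //; exact: ideal_equiv_refl.
by rewrite -e => -[].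
Qed.

Lemma lattice_shift a b k : lattice a (b + k * a) = lattice a b.
Proof.
apply/seteqP; split=> x [i [j ->]].
  by exists (i + k * j), j; congr (qint _ _); ring.
by exists (i - k * j), j; congr (qint _ _); ring.
Qed.

Lemma lattice_opp a b : lattice (- a) b = lattice a b.
Proof.
by apply/seteqP; split=> x [i [j ->]]; exists (- i), j; congr (qint _ _); ring.
Qed.

(** Multiplication by b - s sends the generators a and b + s to a (b - s) and a c. *)
Lemma lattice_swap a b c : a != 0 -> a * c = b ^+ 2 - D%:Z ->
  ideal_equiv O (lattice a b) (lattice c (- b)).
Proof.
move=> a0 e; exists (qint b (- 1)), a%:~R; split.
- by split; [exact: qint_in_O | rewrite qint_eq0 oppr_eq0 oner_eq0 andbF].
- by split; [exact: O_int | rewrite intr_eq0].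
have key i j : qint b (- 1) * qint (a * i + b * j) j = a%:~R * qint (c * j + (- b) * (- i)) (- i).
  rewrite qintM qint_scale; congr (qint _ _); last by ring.
  transitivity (a * b * i + (b ^+ 2 - D%:Z) * j); first by ring.
  by rewrite -e; ring.
apply/seteqP; split=> x [_ [i [j ->]] <-].
  by rewrite key; exists (qint (c * j + - b * - i) (- i)) => //; exists j, (- i).
exists (qint (a * (- j) + b * i) i); first by exists (- j), i.
by rewrite key opprK.
Qed.

(* While a > D, replacing b by its residue mod a and then a by |b^2 - D|/a
   makes a smaller. *)
Lemma gauss_reduce (a b : int) : 0 < a -> (a %| b ^+ 2 - D%:Z)%Z ->
  exists a' b' : int, [/\ 0 < a' <= D%:Z, 0 <= b' <= D%:Z, (a' %| b' ^+ 2 - D%:Z)%Z &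
    ideal_equiv O (lattice a b) (lattice a' b')].
Proof.
have [n] := ubnP `|a|%N; elim: n a b => // n IH a b an a0 ab.
have an0 : a != 0 by rewrite gt_eqF.
have eb := divz_eq b a; set b1 := (b %% a)%Z in eb; set q := (b %/ a)%Z in eb.
have b10 : 0 <= b1 by exact: modz_ge0.
have b1a : b1 < a by exact: ltz_pmod.
have el : lattice a b = lattice a b1 by rewrite eb addrC lattice_shift.
have ab1 : (a %| b1 ^+ 2 - D%:Z)%Z.
  move/dvdzP: ab => [c ec]; apply/dvdzP; exists (c - (q ^+ 2 * a + 2 * q * b1)).
  by rewrite mulrBl -ec eb; ring.
rewrite el; have [aD|Da] := lerP a D%:Z.
  exists a, b1; split; rewrite ?a0 ?aD ?b10 //=; first by lia.
  exact: ideal_equiv_refl.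
have /dvdzP [c ec] := ab1.
have D0 : 0 < D%:Z by rewrite Dt; lia.
have c0 : c != 0.
  have : b1 ^+ 2 - D%:Z * 1 ^+ 2 != 0 by apply: norm_neq0; rewrite oner_eq0 orbT.
  by rewrite expr1n mulr1 ec; apply: contra => /eqP ->; rewrite mul0r.
(* Both b1^2 and D lie below a^2, hence so does the absolute value of their difference c a. *)
have ca : `|c| < a.
  rewrite -(ltr_pM2r a0) -{1}(gtr0_norm a0) -normrM -ec ltr_norml.
  have h1 : b1 ^+ 2 < a * a by rewrite expr2 ltr_pM.
  have h2 : D%:Z < a * a by apply: (lt_le_trans Da); rewrite ler_peMl // ltW.
  by have := sqr_ge0 b1; lia.
have [|||a' [b' [Ha Hb Hd He]]] := IH `|c| (- b1).
- by move: an ca; lia.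
- by rewrite normr_gt0.
- by rewrite sqrrN ec; apply/dvdzP; exists (Num.sg c * a); rewrite {1}[c]numEsg; ring.
exists a', b'; split=> //; apply: ideal_equiv_trans He.
have -> : lattice `|c| (- b1) = lattice c (- b1).
  by case: (ger0P c) => _; rewrite ?lattice_opp.
by apply: lattice_swap => //; rewrite mulrC.
Qed.

Lemma class_group_finite : exists h : nat, ideal_classes O #= `I_h.
Proof.
pose cl (p : 'I_D.+1 * 'I_D.+1) := ideal_class O (lattice (p.1 : nat)%:Z (p.2 : nat)%:Z).
apply: (@sub_finite_set _ _ (range cl)); last by apply: finite_image; exact: finite_finset.
move=> _ [J nJ <-].
have [g [a [b [c [g0 a0 e eJ]]]]] := ideal_lattice nJ.
have [|a' [b' [/andP[a'0 a'D] /andP[b'0 b'D] _ He]]] := @gauss_reduce a b a0.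
  by apply/dvdzP; exists c; rewrite -e mulrC.
have la : (`|a'| < D.+1)%N by lia.
have lb : (`|b'| < D.+1)%N by lia.
exists (Ordinal la, Ordinal lb) => //; rewrite /cl /= !gez0_abs //; last exact: ltW.
apply: ideal_class_eq; apply: ideal_equiv_sym; apply: ideal_equiv_trans He.
exists 1, g%:~R; split.
- by split; [exact: O_1 | exact: oner_neq0].
- by split; [exact: O_int | rewrite intr_eq0].
apply/seteqP; split=> x.
  by move=> [y /eJ [z lz ->] <-]; exists z; rewrite ?mul1r.
by move=> [z lz <-]; exists (g%:~R * z); rewrite ?mul1r //; apply/eJ; exists z.
Qed.

(* A lattice aZ + (b + s)Z times its conjugate is a * (a, 2b, c), and the gcd of
   a, 2b, c is 1 because D is squarefree and even. *)
Lemma ideal_invertible J : nonzero_ideal O J ->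
  exists m x1 x2 y1 y2, [/\ m != 0, J x1, J x2, m = x1 * y1 + x2 * y2 &
    forall z, J z -> (exists2 o, O o & z * y1 = m * o) /\ (exists2 o, O o & z * y2 = m * o)].
Proof.
move=> nJ; have [g [a [b [c [g0 a0 e eJ]]]]] := ideal_lattice nJ.
have [u [v [w uvw]]] : exists u v w : int, a * u + 2 * b * v + c * w = 1.
  have [v1 [w1 e1]] := Bezoutz (2 * b) c.
  have [u [v2 e2]] := Bezoutz a (gcdz (2 * b) c).
  exists u, (v2 * v1), (v2 * w1).
  transitivity (u * a + v2 * (v1 * (2 * b) + w1 * c)); first by ring.
  rewrite e1 e2; apply/eqP/negPn/negP => g1.
  set G := gcdz a _ in g1.
  have G0 : G != 0 by rewrite gcdz_eq0 negb_and gt_eqF.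
  have G1 : (1 < `|G|)%N.
    have : 0 <= G by [].
    by move: G0 g1; lia.
  have pp := pdiv_prime G1; set p := pdiv _ in pp.
  have pG : (p%:Z %| G)%Z by rewrite dvdzE /= pdiv_dvd.
  have pa : (p%:Z %| a)%Z by apply: dvdz_trans pG (dvdz_gcdl _ _).
  have pg : (p%:Z %| gcdz (2 * b)%R c)%Z by apply: dvdz_trans pG (dvdz_gcdr _ _).
  have pb2 : (p%:Z %| 2 * b)%Z by apply: dvdz_trans pg (dvdz_gcdl _ _).
  have pc : (p%:Z %| c)%Z by apply: dvdz_trans pg (dvdz_gcdr _ _).
  (* For p = 2, b^2 = a c + D is even because a and D are. *)
  have pb : (p %| `|b|)%N.
    move: pb2; rewrite dvdzE abszM Euclid_dvdM // => /orP[|//].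
    rewrite /= dvdn_prime2 // => /eqP p2; rewrite p2 dvdn2.
    have : (2 %| `|b ^+ 2|)%N.
      rewrite (_ : b ^+ 2 = a * c + D%:Z); last by rewrite e; ring.
      have : (2%:Z %| a * c + D%:Z)%Z.
        by rewrite p2 in pa; rewrite rpredD ?dvdz_mulr // dvdzE /= dvdn2.
      by rewrite dvdzE.
    by rewrite abszX Euclid_dvdX // dvdn2 => /andP[].
  have /dvdzP [b' eb'] : (p%:Z %| b)%Z by rewrite dvdzE.
  have /dvdzP [a' ea'] := pa; have /dvdzP [c' ec'] := pc.
  have : ((p ^ 2)%:Z %| D%:Z)%Z.
    apply/dvdzP; exists (b' ^+ 2 - a' * c').
    rewrite (_ : D%:Z = b ^+ 2 - a * c); last by rewrite e; ring.
    by rewrite ea' eb' ec' PoszM; ring.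
  by rewrite dvdzE /= => /Dsq p1; rewrite p1 in pp.
(* y1 = a u + v (b - s) and y2 = a v + w (b - s) lie in the conjugate lattice, and x1 y1 + x2 y2 = g
   a (a u + 2 b v + c w) = m. So y1 / m and y2 / m belong to the inverse of J. *)
exists (qint (g * a) 0), (qint (g * a) 0), (qint (g * b) g),
  (qint (a * u + b * v) (- v)), (qint (a * v + b * w) (- w)); split.
- by rewrite qint_eq0 mulf_eq0 negb_and negb_or g0 gt_eqF.
- apply/eJ; exists (qint a 0); last by rewrite qint_scale mulr0.
  by exists 1, 0; congr (qint _ _); ring.
- apply/eJ; exists (qint b 1); last by rewrite qint_scale mulr1.
  by exists 0, 1; congr (qint _ _); ring.
- rewrite !qintM qintD; congr (qint _ _); last by ring.
  transitivity (g * a * (a * u + 2 * b * v + c * w)); first by rewrite uvw mulr1.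
  transitivity (g * a * (a * u + 2 * b * v) + g * w * (a * c)); first by ring.
  by rewrite e; ring.
- move=> _ /eJ [_ [i [j ->]] ->]; rewrite qint_scale.
  have key k l : qint (g * (a * i + b * j)) (g * j) * qint (a * k + b * l) (- l) =
      qint (g * a) 0 * qint ((a * i + b * j) * k + b * i * l + c * j * l) (j * k - i * l).
    rewrite !qintM; congr (qint _ _); last by ring.
    transitivity (g * a * ((a * i + b * j) * k + b * i * l) + g * j * l * (b ^+ 2 - D%:Z));
      first by ring.
    by rewrite -e; ring.
  by split; eexists; try exact: key; exact: qint_in_O.
Qed.

(* The product of J with the ideal (m, 1 + s). *)
Definition twist (m : int) (J : set algC) : set algC :=
  [set z | exists x y, [/\ J x, J y & z = m%:~R * x + (1 + s) * y]].

Lemma omegaE : 1 + s = qint 1 1.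
Proof. by rewrite /qint mul1r. Qed.

Lemma O_omega : O (1 + s). Proof. by rewrite omegaE; exact: qint_in_O. Qed.

Lemma omega_neq0 : 1 + s != 0.
Proof. by rewrite omegaE qint_eq0 oner_eq0. Qed.

Lemma omega_sqr : (1 + s) * (1 + s) = 2 * (1 + s) + (D%:R - 1).
Proof. by rewrite -sqr_s; ring. Qed.

Lemma twist_ideal m J : m != 0 -> nonzero_ideal O J -> nonzero_ideal O (twist m J).
Proof.
move=> m0 [JO J0 JD JM [al Jal al0]]; split.
- move=> _ [x [y [Jx Jy ->]]]; apply: O_D.
    by apply: O_M; [exact: O_int | exact: JO].
  by apply: O_M; [exact: O_omega | exact: JO].
- by exists 0, 0; rewrite !mulr0 addr0.
- move=> _ _ [x [y [Jx Jy ->]]] [z [w [Jz Jw ->]]].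
  by exists (x + z), (y + w); split; [exact: JD | exact: JD | ring].
- move=> a _ Oa [x [y [Jx Jy ->]]].
  by exists (a * x), (a * y); split; [exact: JM | exact: JM | ring].
- exists (m%:~R * al); last by rewrite mulf_neq0 // intr_eq0.
  by exists al, 0; rewrite mulr0 addr0.
Qed.

Lemma twist_equiv m J K : ideal_equiv O J K -> ideal_equiv O (twist m J) (twist m K).
Proof.
move=> [a [b [Ha Hb e]]]; exists a, b; split=> //.
have half c d I I' : ( *%R c) @` I = ( *%R d) @` I' ->
    ( *%R c) @` twist m I `<=` ( *%R d) @` twist m I'.
  move=> ecd _ [_ [x [y [Ix Iy ->]]] <-].
  have [x' Ix' ex] : (( *%R d) @` I') (c * x) by rewrite -ecd; exists x.
  have [y' Iy' ey] : (( *%R d) @` I') (c * y) by rewrite -ecd; exists y.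
  exists (m%:~R * x' + (1 + s) * y'); first by exists x', y'.
  transitivity (m%:~R * (d * x') + (1 + s) * (d * y')); first by ring.
  by rewrite ex ey; ring.
by apply/seteqP; split; exact: half.
Qed.

(* (1 + s)^2 = 2 (1 + s) + (D - 1), with 2 invertible mod M. *)
Lemma twist_comp (M m q : int) J : ~~ (2 %| M)%Z -> D%:Z - 1 = M * m * q ->
  nonzero_ideal O J -> twist M (twist m J) = twist (M * m) J.
Proof.
move=> oM eq [JO J0 JD JM _].
have JZ k x : J x -> J (k%:~R * x) by apply: JM; exact: O_int.
have eqC : (D%:R - 1 : algC) = (M * m * q)%:~R by rewrite -eq rmorphB.
apply/seteqP; split=> x.
  move=> [_ [_ [[x1 [y1 [Jx1 Jy1 ->]]] [x2 [y2 [Jx2 Jy2 ->]]] ->]]].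
  exists (x1 + q%:~R * y2), (M%:~R * y1 + m%:~R * x2 + 2%:~R * y2); split.
  - by apply: JD => //; exact: JZ.
  - by apply: (JD); [apply: (JD)|]; exact: JZ.
  transitivity (M%:~R * m%:~R * x1 + (1 + s) * (M%:~R * y1 + m%:~R * x2) + (1 + s) * (1 + s) * y2); first by ring.
  by rewrite omega_sqr eqC !rmorphM /=; ring.
move=> [x1 [y1 [Jx1 Jy1 ->]]].
(* As 1 = M - 2 h and 2 (1 + s) = (1 + s)^2 - M m q, one gets 1 + s = M (1 + s) - h (1 + s)^2 + h M
   m q. *)
have [h eh] : exists h, M = 2 * h + 1.
  by exists (M %/ 2)%Z; lia.
exists (m%:~R * (x1 + (q * h)%:~R * y1) + (1 + s) * y1), (m%:~R * 0 + (1 + s) * ((- h)%:~R * y1)); split.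
- by exists (x1 + (q * h)%:~R * y1), y1; split=> //; apply: JD => //; exact: JZ.
- by exists 0, ((- h)%:~R * y1); split=> //; exact: JZ.
transitivity (M%:~R * m%:~R * (x1 + q%:~R * h%:~R * y1) + M%:~R * (1 + s) * y1
   - (1 + s) * (1 + s) * h%:~R * y1); last by rewrite rmorphM rmorphN /=; ring.
have eh' : M%:~R - 2 * h%:~R = 1 :> algC by rewrite eh rmorphD rmorphM rmorph1 /=; ring.
transitivity (M%:~R * m%:~R * x1 + (M%:~R - 2 * h%:~R) * (1 + s) * y1).
  by rewrite eh' mul1r rmorphM.
by rewrite omega_sqr eqC !rmorphM /=; ring.
Qed.

Lemma twist1 J : nonzero_ideal O J -> twist 1 J = J.
Proof.
move=> [JO J0 JD JM _]; apply/seteqP; split=> x.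
  move=> [x1 [y1 [Jx1 Jy1 ->]]]; apply: JD; first by rewrite mul1r.
  by apply: JM => //; exact: O_omega.
by move=> Jx; exists x, 0; rewrite mulr0 addr0 mul1r.
Qed.

(** D - 1 = (s + 1)(s - 1), so the ideal (D - 1, 1 + s) is generated by 1 + s. *)
Lemma twist_full J : nonzero_ideal O J -> ideal_equiv O (twist (D%:Z - 1) J) J.
Proof.
move=> [JO J0 JD JM _]; exists 1, (1 + s); split.
- by split; [exact: O_1 | exact: oner_neq0].
- by split; [exact: O_omega | exact: omega_neq0].
have eD : ((D%:Z - 1)%:~R : algC) = (1 + s) * (s - 1).
  by rewrite rmorphB /= -[D%:~R]sqr_s; ring.
apply/seteqP; split=> x.
  move=> [_ [x1 [y1 [Jx1 Jy1 ->]]] <-]; exists ((s - 1) * x1 + y1); last by rewrite eD; ring.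
  apply: JD => //; apply: JM => //.
  by rewrite (_ : s - 1 = qint (- 1) 1); [exact: qint_in_O | rewrite /qint; ring].
by move=> [y Jy <-]; exists ((1 + s) * y); rewrite ?mul1r //; exists 0, y; rewrite mulr0 add0r.
Qed.

(* Cancelling J makes (m, 1 + s) principal; comparing the determinants of the
   bases of both lattices shows that a generator has norm m or -m. *)
Lemma twist_not_equiv (m q : int) J : 1 < m -> m <= t%:Z -> D%:Z - 1 = m * q ->
  nonzero_ideal O J -> ~ ideal_equiv O (twist m J) J.
Proof.
move=> m1 mt eq nJ [al [be [[Oal al0] [Obe be0] e]]].
have [JO J0 JD JM _] := nJ.
have [mm [x1 [x2 [y1 [y2 [mm0 Jx1 Jx2 emm inv]]]]]] := ideal_invertible nJ.
have toJ z : twist m J z -> exists2 j, J j & al * z = be * j.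
  move=> Tz; have [j Jj ej] : (( *%R be) @` J) (al * z) by rewrite -e; exists z.
  by exists j.
have fromJ j : J j -> exists2 z, twist m J z & be * j = al * z.
  move=> Jj; have [z Tz ez] : (( *%R al) @` twist m J) (be * j) by rewrite e; exists j.
  by exists z.
(* With gamma = be / al, the twist of J is gamma J. If w J lies in it, then w / gamma maps J into J,
   and invertibility of J makes it an integer. *)
have quot w : (forall x, J x -> twist m J (w * x)) -> exists2 o, O o & al * w = be * o.
  move=> Hw; have [j1 Jj1 e1] := toJ _ (Hw _ Jx1); have [j2 Jj2 e2] := toJ _ (Hw _ Jx2).
  have [[o1 Oo1 eo1] _] := inv _ Jj1; have [_ [o2 Oo2 eo2]] := inv _ Jj2.
  exists (o1 + o2); first exact: O_D.
  apply: (mulfI mm0); rewrite [in LHS]emm.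
  transitivity (al * (w * x1) * y1 + al * (w * x2) * y2); first by ring.
  by rewrite e1 e2 -!mulrA eo1 eo2; ring.
have [om Oom eom] := quot m%:~R (fun x Jx => ex_intro _ x (ex_intro _ 0
  (And3 Jx J0 (esym (etrans (congr1 _ (mulr0 _)) (addr0 _)))))).
have [ow Oow eow] := quot (1 + s) (fun x Jx => ex_intro _ 0 (ex_intro _ x
  (And3 J0 Jx (esym (etrans (congr1 (fun u => u + _) (mulr0 _)) (add0r _)))))).
(* Conversely gamma J lies in (m, 1 + s) J, and cancelling J puts gamma in (m, 1 + s). *)
have [o1 [o2 [Oo1 Oo2 ego]]] : exists o1 o2, [/\ O o1, O o2 & be = al * (m%:~R * o1 + (1 + s) * o2)].
  have [_ [u1 [v1 [Ju1 Jv1 ->]]] e1] := fromJ _ Jx1.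
  have [_ [u2 [v2 [Ju2 Jv2 ->]]] e2] := fromJ _ Jx2.
  have [[p1 Op1 ep1] _] := inv _ Ju1; have [[r1 Or1 er1] _] := inv _ Jv1.
  have [_ [p2 Op2 ep2]] := inv _ Ju2; have [_ [r2 Or2 er2]] := inv _ Jv2.
  exists (p1 + p2), (r1 + r2); split; try exact: O_D.
  apply: (mulfI mm0); rewrite [in LHS]emm.
  transitivity (be * x1 * y1 + be * x2 * y2); first by ring.
  rewrite e1 e2.
  transitivity (al * (m%:~R * (u1 * y1 + u2 * y2) + (1 + s) * (v1 * y1 + v2 * y2)));
    first by ring.
  by rewrite ep1 ep2 er1 er2; ring.
move: eom eow; rewrite ego -!mulrA => /(mulfI al0) eom /(mulfI al0) eow {e toJ fromJ quot ego}.
move: Oo1 Oo2 Oom Oow => /O_qint [i [j e1]] /O_qint [k [l e2]] /O_qint [p [r e3]] /O_qint [p' [r' e4]].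
pose x := m * i + k + D%:Z * l; pose y := m * j + k + l.
have eg : m%:~R * o1 + (1 + s) * o2 = qint x y.
  rewrite e1 e2 omegaE qintM (_ : _ * qint i j = qint (m * i) (m * j));
    last by rewrite /qint !rmorphM /=; ring.
  by rewrite qintD; congr (qint _ _); rewrite /x /y; ring.
rewrite eg e3 qintM in eom; rewrite eg e4 omegaE qintM in eow.
have [em0 em1] : m = x * p + D%:Z * y * r /\ 0 = x * r + y * p.
  by apply: qint_inj; rewrite -eom /qint mul0r addr0.
have [ew0 ew1] := qint_inj eow.
have mdet : m = (p * r' - r * p') * (x ^+ 2 - D%:Z * y ^+ 2).
  transitivity (m * (x * r' + y * p') - 0 * (x * p' + D%:Z * y * r')).
    by rewrite -ew1; ring.
  by rewrite em0 em1; ring.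
(* Modulo m, D = 1, and x = y because gamma = x + y s lies in (m, 1 + s). *)
have mN : (m %| x ^+ 2 - D%:Z * y ^+ 2)%Z.
  apply/dvdzP; exists ((i + q * l - j) * (x + y) - q * y ^+ 2).
  have eD : D%:Z = m * q + 1 by rewrite -eq; ring.
  have exy : x - y = m * (i + q * l - j) by rewrite /x /y eD; ring.
  transitivity ((x - y) * (x + y) - (D%:Z - 1) * y ^+ 2); first by ring.
  by rewrite eq exy; ring.
have Nm : (x ^+ 2 - D%:Z * y ^+ 2 %| m)%Z by apply/dvdzP; exists (p * r' - r * p').
have eDt : D%:Z = t%:Z ^+ 2 + 1 by rewrite Dt PoszD; lia.
have eabs : `|x ^+ 2 - D%:Z * y ^+ 2| = m.
  have m0 : 0 <= m by apply: ltW; apply: lt_trans m1.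
  rewrite -[RHS](ger0_norm m0) -!abszE; congr Posz.
  by apply/eqP; rewrite eqn_dvd -!dvdzE Nm mN.
have [||d [dx dy ed]] := @small_norm_square t%:Z x y; rewrite -?eDt ?eabs //.
rewrite -eDt in ed.
(* gamma is primitive: it divides 1 + s, whose coefficient of s is 1. *)
have d1 : (d %| (1 : int)%R)%Z by rewrite ew1 rpredD // dvdz_mulr.
rewrite eabs in ed.
move: d1; rewrite dvdz1 => /eqP d1.
have : d ^+ 2 = 1 by rewrite -(real_normK (num_real d)) -abszE d1 expr1n.
by rewrite -ed => m1'; rewrite m1' in m1.
Qed.

End Quadratic.

Lemma class_number_dvd (M n : nat) :
  odd M -> (1 < M)%N -> (0 < n)%N -> squarefree (M ^ (2 * n) + 1) ->
  exists h : nat,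
    is_class_number (adjoinQ (sqrtC (M ^ (2 * n) + 1)%:R)) h /\ (2 * n %| h)%N.
Proof.
move=> oM M1 n0 sqD; set D := (M ^ (2 * n) + 1)%N; pose t := (M ^ n)%N.
have M0 : (0 < M)%N := ltnW M1.
have t0 : (0 < t)%N by rewrite expn_gt0 M0.
have Dt : D = (t ^ 2 + 1)%N by rewrite /D mulnC expnM.
have De : ~~ odd D by rewrite /D oddD oddX oM orbT.
rewrite /is_class_number; set O := ring_of_integers _.
have [h hP] : exists h : nat, ideal_classes O #= `I_h := class_group_finite t0 Dt De sqD.
exists h; split=> //.
have Mz k : (M%:Z ^+ k) != 0 :> int by rewrite expf_neq0 // -lt0n.
have nD : D%:Z - 1 = M%:Z ^+ (2 * n).
  by rewrite /D PoszD addrK -[M%:Z]natz -natrX natz.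
(* Multiplication by P^k, as P^k = (M^k, 1 + s) for k <= 2n by [twist_comp]. *)
pose tw k J := twist D (M%:Z ^+ k) J.
have tw_ideal k J : nonzero_ideal O J -> nonzero_ideal O (tw k J).
  exact: twist_ideal t0 Dt De sqD _ _ (Mz k).
(* Using all members of the class c avoids choosing a representative. *)
pose sigma (c : set (set algC)) : set (set algC) :=
  [set K | nonzero_ideal O K /\ exists2 J, c J & ideal_equiv O (tw 1%N J) K].
have sigmaE J : nonzero_ideal O J -> sigma (ideal_class O J) = ideal_class O (tw 1%N J).
  move=> nJ; apply/seteqP; split=> K [nK].
    move=> [I [nI eI] eK]; split=> //; apply: (ideal_equiv_trans t0 Dt De sqD) eK.
    exact: twist_equiv.
  by move=> eK; split=> //; exists J => //; split=> //; exact: (ideal_equiv_refl t0 Dt De sqD).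
have tw0 J : nonzero_ideal O J -> tw 0%N J = J.
  by move=> nJ; rewrite /tw expr0; exact: (twist1 t0 Dt De sqD).
have twS k J : (k < 2 * n)%N -> nonzero_ideal O J -> tw 1%N (tw k J) = tw k.+1 J.
  move=> kn nJ; rewrite /tw [_ ^+ k.+1]exprS expr1.
  apply: (@twist_comp D t t0 Dt De sqD _ _ (M%:Z ^+ (2 * n - k.+1))) => //.
    by rewrite dvdzE /= dvdn2 oM.
  by rewrite nD -exprS -exprD subnKC.
have iterE k J : (k <= 2 * n)%N -> nonzero_ideal O J ->
    iter k sigma (ideal_class O J) = ideal_class O (tw k J).
  move=> + nJ; elim: k => [|k IH] kn; first by rewrite tw0.
  by rewrite iterS (IH (ltnW kn)) (sigmaE _ (tw_ideal k J nJ)) (twS k J kn nJ).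
have full c : ideal_classes O c -> iter (2 * n) sigma c = c.
  move=> [J nJ <-]; rewrite iterE //; apply: (ideal_class_eq t0 Dt De sqD).
  by rewrite /tw -nD; exact: (twist_full t0 Dt De sqD).
have free c k : ideal_classes O c -> (0 < k <= n)%N -> iter k sigma c <> c.
  move=> [J nJ <-] /andP[k0 kn]; have kn2 : (k <= 2 * n)%N by lia.
  rewrite iterE // => /(ideal_class_inj t0 Dt De sqD nJ).
  apply: (@twist_not_equiv D t t0 Dt De sqD _ (M%:Z ^+ (2 * n - k))) => //.
  - by rewrite exprn_egt1 // -lt0n.
  - have -> : t%:Z = M%:Z ^+ n by rewrite -[M%:Z]natz -natrX natz.
    by rewrite ler_weXn2l // ler1n.
  - by rewrite nD -exprD subnKC.
apply: (free_cyclic_action_dvd hP _ _ full _); first by rewrite muln_gt0.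
  move=> _ [J nJ <-]; rewrite sigmaE //; exists (tw 1%N J) => //; exact: tw_ideal.
move=> c k Cc /andP[k0 kn]; have [le|gt] := leqP k n; first by apply: free => //; rewrite k0.
(* For n < k < 2n, a class fixed by k steps is also fixed by the 2n - k steps that complete the full
   turn. *)
move=> e; apply: (free c (2 * n - k)%N Cc); first by lia.
by rewrite -[in LHS]e -iterD (subnK (ltnW kn)) full.
Qed.

End ClassNumber.

Theorem theorem1p7 (N b : nat)
    (hb : (1 <= b)%N) (hN : (6 <= N)%N) (hN4 : N = 2 %[mod 4])
    (hirr : irreducibleQ (trinomial N b)) :
  [/\ monogenic (trinomial N b) <->
        squarefree (N * (N - 1))%N /\ squarefree (delta N b),
      forall b' : nat, (1 <= b')%N ->
        monogenic (trinomial N b) -> monogenic (trinomial N b') ->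
        trinomial N b <> trinomial N b' ->
        ~ same_extension (trinomial N b) (trinomial N b')
    & monogenic (trinomial N b) ->
        exists h : nat,
          is_class_number (adjoinQ (sqrtC (delta N b)%:R)) h /\
          ((b * N) %/ 2 %| h)%N].
Proof.
have [M eN M4] : exists2 M, N = M.+1 & (4 < M)%N by exists N.-1; lia.
rewrite eN in hirr hN4 *; rewrite /delta -(addn1 M) addnK addn1.
have oN : ~~ odd M.+1 by lia.
split.
- exact: trinomial_monogenicP.
- move=> b' hb' mon mon' ne; case: (ltngtP b b') => [lt|gt|e].
  + exact: trinomial_distinct_fields.
  + move=> [z [z' [fz fz' e]]].
    by apply: (@trinomial_distinct_fields M b' b) => //; exists z', z.
  + by case: ne; rewrite e.
- move=> /(trinomial_monogenicP M4 hb hN4 hirr).1 [_ sqD].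
  have [n en] : exists n, (b * M.+1)%N = (2 * n)%N.
    have /dvdnP [k ->] : (2 %| M.+1)%N by rewrite dvdn2.
    by exists (b * k)%N; rewrite mulnA mulnC.
  rewrite en in sqD *; rewrite mulKn //.
  have [|||h [hP hd]] := class_number_dvd _ _ _ sqD.
  + by move: oN; rewrite /= negbK.
  + exact: ltn_trans M4.
  + by move: hb; case: (n) en => // /eqP; rewrite muln0 muln_eq0 orbF => /eqP ->.
  by exists h; split=> //; apply: dvdn_trans hd; exact: dvdn_mull.
Qed.
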